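(* Let $i\in\mathbb{N}$, $\alpha\in\mathbb{R}$ and $\beta\ge0$. (1) The function $x\mapsto\alpha\bigl|\psi^{(i)}(x)\bigr|-x\bigl|\psi^{(i+1)}(x)\bigr|$ is completely monotonic on $(0,\infty)$ if and only if $\alpha\ge i+1$. (2) The function $x\mapsto x\bigl|\psi^{(i+1)}(x)\bigr|-\alpha\bigl|\psi^{(i)}(x)\bigr|$ (the negative of the function in (1)) is completely monotonic on $(0,\infty)$ if and only if $\alpha\le i$. (3) If $\beta\ge\frac12$, then the function $x\mapsto\alpha\bigl|\psi^{(i)}(x+\beta)\bigr|-x\bigl|\psi^{(i+1)}(x+\beta)\bigr|$ is completely monotonic on $(0,\infty)$ if and only if $\alpha\ge i$. (4) If $0<\beta<\frac12$ and $$\alpha\ge i+1-\biggl[\frac{e^{\delta^{-1}(\beta)}}{e^{\delta^{-1}(\beta)}-1}+\beta-1\biggr]\delta^{-1}(\beta),$$ then the function $x\mapsto\alpha\bigl|\psi^{(i)}(x+\beta)\bigr|-x\bigl|\psi^{(i+1)}(x+\beta)\bigr|$ is completely monotonic on $(0,\infty)$.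
   Context: Here $\mathbb{N}=\{1,2,3,\dots\}$. For $x>0$, $\Gamma(x)=\int_0^\infty t^{x-1}e^{-t}\,dt$ is the Euler gamma function, $\psi(x)=\Gamma'(x)/\Gamma(x)$ is the psi (digamma) function, and $\psi^{(k)}$ for $k\in\mathbb{N}$ denotes the $k$-th derivative of $\psi$ (a polygamma function). A function $f$ is completely monotonic on an interval $I\subseteq\mathbb{R}$ if $f$ has derivatives of all orders on $I$ and $0\le(-1)^kf^{(k)}(x)<\infty$ for all $x\in I$ and all integers $k\ge0$. The function $\delta:(0,\infty)\to\bigl(0,\frac12\bigr)$ is defined by $\delta(t)=\frac{e^t(t-1)+1}{(e^t-1)^2}$; it is a strictly decreasing bijection from $(0,\infty)$ onto $\bigl(0,\frac12\bigr)$, and $\delta^{-1}:\bigl(0,\frac12\bigr)\to(0,\infty)$ denotes its inverse function. *)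

(* Defs.v *)
From mathcomp Require Import all_boot all_order all_algebra.
From mathcomp Require Import all_classical all_reals all_analysis.

Set Implicit Arguments.
Unset Strict Implicit.
Unset Printing Implicit Defensive.

Import Order.TTheory GRing.Theory Num.Theory.
Import numFieldNormedType.Exports.

Local Open Scope ring_scope.
Local Open Scope classical_set_scope.

(* The integrand is nonnegative; for 0 < x the integral is finite, so taking
   its real value loses nothing. Values at x <= 0 are irrelevant. *)
Definition Gamma (R : realType) (x : R) : R :=
  \int[lebesgue_measure]_(t in `]0%R, +oo[) (t `^ (x - 1) * expR (- t)).

Definition psi (R : realType) (x : R) : R := (@Gamma R)^`()%classic x / Gamma x.

Definition polygamma (R : realType) (k : nat) : R -> R := (@psi R)^`(k).

(* Iterated derivatives are total functions, hence the explicit derivability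
   of each of them. Derivatives are two-sided: A is meant to be an open
   interval. *)
Definition completely_monotonic (R : realType) (A : set R) (f : R -> R) : Prop :=
  forall (k : nat) (x : R), A x ->
    derivable f^`(k) x 1 /\ 0 <= (-1) ^+ k * f^`(k)%classic x.

Definition delta (R : realType) (t : R) : R :=
  (expR t * (t - 1) + 1) / (expR t - 1) ^+ 2.

(* Inverse of delta restricted to ]0, +oo[; 0 outside the range ]0, 1/2[. *)
Definition delta_inv (R : realType) : R -> R :=
  'pinv_(fun=> 0) `]0, +oo[ (@delta R).

(* Main.v *)
Require Import Defs.
From mathcomp Require Import all_boot all_order all_algebra.
From mathcomp Require Import all_classical all_reals all_analysis.
From mathcomp Require Import measurable_realfun ring lra.

Set Implicit Arguments.
Unset Strict Implicit.
Unset Printing Implicit Defensive.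

Import Order.TTheory GRing.Theory Num.Theory.
Import numFieldNormedType.Exports.

Local Open Scope ring_scope.
Local Open Scope classical_set_scope.

(** The functional equation and the log-convexity of Gamma determine its logarithmic
    derivative up to errors that vanish along [x + n], so that psi is the limit of
    [ln (x + n) - \sum_(k < n) (x + k)^-1] and, up to sign, psi^(i) is [i`! * Z (i + 1)]
    with [Z m x = \sum_k (x + k) ^- m] ([hzeta] below).  Complete monotonicity of all the
    functions at hand is then, for [y = x + beta], [N = i + k + 1] and every [k], an
    inequality between [Z N y] and [x * Z N.+1 y].

    Sufficiency: a pointwise inequality
      [m * (1 - expR (- t)) <= a * t + b * (t * expR (- t))]  for [t >= 0]
    becomes, after integration against [t ^+ (N - 1) * expR (- (u * t))],
      [m * (u ^- N - (u + 1) ^- N) <= N * (a * u ^- N.+1 + b * (u + 1) ^- N.+1)],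
    and summing with weights [j + 1] over [u = y + j] gives
      [m * Z N y <= N * ((a + b) * Z N y + (a - (a + b) * y) * Z N.+1 y)].
    The triples (m, a, b) are (0, 0, 1), (-1, 0, -1), (1, beta, 1 - beta), and
    (min_t (t / (expR t - 1) + beta * t), beta, 1 - beta); that minimum is attained where
    [delta t = beta].  Necessity: let x tend to 0 or to infinity in the case [k = 0]. *)

(** * Limits of sequences and criteria for differentiability *)

Lemma ler_cvgn (R : realType) (u v : nat -> R) (a b : R) :
  u @ \oo --> a -> v @ \oo --> b -> (\forall n \near \oo, u n <= v n) -> a <= b.
Proof.
move=> ua vb uv; rewrite -(cvg_lim _ ua)// -(cvg_lim _ vb)//.
by apply: ler_lim uv; apply/cvg_ex; [exists a|exists b].
Qed.

Lemma is_derive_ge0_le (R : realType) (f df : R -> R) (a b : R) : a <= b ->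
  (forall x, a <= x <= b -> is_derive x 1 f (df x)) ->
  (forall x, a <= x <= b -> 0 <= df x) -> f a <= f b.
Proof.
move=> ab fE df0; have [||c cab fba] := @MVT_segment R f df a b ab.
- by move=> x; rewrite in_itv/= => /andP[/ltW ax /ltW xb]; apply: fE; rewrite ax.
- apply: derivable_within_continuous => x; rewrite in_itv/= => xab.
  by case: (fE _ xab).
- by rewrite -subr_ge0 fba mulr_ge0 ?subr_ge0 ?df0 //; move: cab; rewrite in_itv.
Qed.

(** Divided by [h], the remainder is still of order [h], so the difference quotient tends to [d]. *)
Lemma is_derive_quadratic (R : realType) (f : R -> R) (x d C r : R) : 0 < r ->
  (forall h, `|h| < r -> `|f (x + h) - f x - h * d| <= C * h ^+ 2) ->
  is_derive x 1 f d.
Proof.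
move=> r0 fC.
have C0 : 0 <= C.
  have /fC : `|r / 2| < r by rewrite ger0_norm; lra.
  move=> /(le_trans (normr_ge0 _)); rewrite pmulr_lge0// exprn_gt0//; lra.
have cvgd : h^-1 *: (f (h *: 1%R + x) - f x) @[h --> 0^'] --> d.
  apply/cvgrPdist_le => e e0; near=> h.
  have hr : `|h| < r by near: h; apply: dnbhs0_lt.
  have he : `|h| <= e / (C + 1).
    by near: h; apply: dnbhs0_le; rewrite divr_gt0//; lra.
  have h0 : h != 0 by near: h; exact: nbhs_dnbhs_neq.
  rewrite distrC /= [h *: 1%R]mulr1 (addrC h).
  have -> : h^-1 *: (f (x + h) - f x) - d = (f (x + h) - f x - h * d) / h.
    by rewrite [_ *: _]mulrC; field.
  rewrite normrM normfV ler_pdivrMr ?normr_gt0//.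
  rewrite (le_trans (fC _ hr))// -normr_id -real_normK ?num_real// normr_id.
  rewrite expr2 mulrA ler_wpM2r//.
  rewrite (le_trans (ler_wpM2l C0 he))// mulrA ler_pdivrMr; [nra|lra].
apply: DeriveDef; first by apply/cvg_ex; exists d.
exact: cvg_lim cvgd.
Unshelve. all: by end_near. Qed.

(** The quadratic error has a constant [C] independent of [n], so it survives the limit and feeds
    [is_derive_quadratic]; the error linear in [h] dies with [eps]. Thus [sn n] need only be an
    approximate slope of [Sn n]. *)
Lemma is_derive_limn (R : realType) (S : R -> R) (Sn : nat -> R -> R)
    (sn eps : nat -> R) (x s C r : R) : 0 < r ->
  (forall h, `|h| < r -> Sn ^~ (x + h) @ \oo --> S (x + h)) ->
  sn @ \oo --> s -> eps @ \oo --> 0 ->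
  (forall h, `|h| < r -> \forall n \near \oo,
    `|Sn n (x + h) - Sn n x - h * sn n| <= `|h| * eps n + C * h ^+ 2) ->
  is_derive x 1 S s.
Proof.
move=> r0 SnS sns eps0 Snb; apply: (@is_derive_quadratic _ _ _ _ C r) => // h hr.
have Sx : Sn ^~ x @ \oo --> S x.
  by rewrite -{2}[x]addr0 -[in Sn ^~ x](addr0 x); apply: SnS; rewrite normr0.
have L : `|Sn n (x + h) - Sn n x - h * sn n| @[n --> \oo] -->
    `|S (x + h) - S x - h * s|.
  apply: cvg_norm; apply: cvgB; first by apply: cvgB => //; exact: SnS.
  exact: cvgMr.
have U : (`|h| * eps n + C * h ^+ 2) @[n --> \oo] --> C * h ^+ 2.
  rewrite -[X in _ --> X]add0r; apply: cvgD; last exact: cvg_cst.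
  by rewrite -[X in _ --> X](mulr0 `|h|); exact: cvgMr.
exact: (ler_cvgn L U) (Snb _ hr).
Qed.

(* The library states these rules on the ring of functions, with which lambda-terms
   unify poorly. *)
Section is_derive_fun.
Context {R : realType}.
Implicit Types (f g : R -> R) (x c : R).

Lemma is_derive_addf f g x df dg : is_derive x 1 f df -> is_derive x 1 g dg ->
  is_derive x 1 (fun t => f t + g t) (df + dg).
Proof. by move=> ? ?; exact: is_deriveD. Qed.

Lemma is_derive_subf f g x df dg : is_derive x 1 f df -> is_derive x 1 g dg ->
  is_derive x 1 (fun t => f t - g t) (df - dg).
Proof. by move=> ? ?; exact: is_deriveB. Qed.

Lemma is_derive_mulf f g x df dg : is_derive x 1 f df -> is_derive x 1 g dg ->
  is_derive x 1 (fun t => f t * g t) (df * g x + f x * dg).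
Proof.
move=> ? ?; have -> : df * g x + f x * dg = f x *: dg + g x *: df.
  by rewrite addrC /GRing.scale/= [g x * _]mulrC.
exact: is_deriveM.
Qed.

Lemma is_derive_scalef c f x df : is_derive x 1 f df ->
  is_derive x 1 (fun t => c * f t) (c * df).
Proof. exact: is_deriveZ. Qed.

Lemma is_derive_expn n x : is_derive x 1 (fun t => t ^+ n.+1) (n.+1%:R * x ^+ n).
Proof.
apply: DeriveDef; first exact: exprn_derivable.
by rewrite -derive1E exp_derive1.
Qed.

Lemma is_derive_compf f g x df dg : is_derive (g x) 1 f df ->
  is_derive x 1 g dg -> is_derive x 1 (fun t => f (g t)) (df * dg).
Proof. by move=> ? ?; exact: is_derive1_comp. Qed.

End is_derive_fun.

(** * Sums of inverse powers *)

Lemma bernoulli_le (R : realType) (s : R) (m : nat) : -1 <= s ->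
  1 + m%:R * s <= (1 + s) ^+ m.
Proof.
move=> s1; elim: m => [|m IH]; first by rewrite expr0 mul0r addr0.
rewrite exprS (le_trans _ (ler_wpM2l _ IH))//; last lra.
rewrite -natr1; have : 0 <= m%:R * s ^+ 2 by rewrite mulr_ge0// sqr_ge0.
by rewrite expr2; nra.
Qed.

(** With [s = h / u] and [q = (1 + s) ^+ m], this is a quadratic bound on [q^-1 - (1 - m%:R * s)].
    Bernoulli at [s] bounds [q] below, hence [q^-1] above; Bernoulli at [- s], with
    [1 - s <= (1 + s)^-1], bounds [q^-1] below. The smallness of [h] keeps [s] and [m%:R * s] within
    1/2 of 0. *)
Lemma exprVn_taylor (R : realType) (u h : R) (m : nat) : 0 < u ->
  (m.+1%:R *+ 2) * `|h| <= u ->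
  `|(u + h) ^- m - u ^- m + h * (m%:R * u ^- m.+1)|
     <= (m%:R ^+ 2 *+ 2) * u ^- m.+2 * h ^+ 2.
Proof.
move=> u0 hu; pose s := h / u.
have hE : h = s * u by rewrite /s mulfVK// gt_eqF.
have : (m.+1%:R *+ 2) * `|s| <= 1.
  by rewrite /s normrM normfV (gtr0_norm u0) mulrA ler_pdivrMr// mul1r.
have m0 : 0 <= m%:R :> R by [].
rewrite -natr1 => ms.
have /[!ler_norml]/andP[s2 s2'] : `|s| <= 2^-1 by have := normr_ge0 s; nra.
have /[!ler_norml]/andP[ms2 ms2'] : `|m%:R * s| <= 2^-1.
  by rewrite normrM (ger0_norm m0); have := normr_ge0 s; nra.
pose q := (1 + s) ^+ m.
have s1 : 0 < 1 + s by lra.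
have q0 : 0 < q by rewrite exprn_gt0.
have qB : 1 + m%:R * s <= q by apply: bernoulli_le; lra.
have qU : q^-1 <= 1 - m%:R * s + (m%:R * s) ^+ 2 *+ 2.
  apply: (@le_trans _ _ (1 + m%:R * s)^-1); first by rewrite lef_pV2// posrE; lra.
  rewrite -[X in X <= _]mul1r ler_pdivrMr; last lra.
  by set t := m%:R * s in ms2 ms2' *; have := sqr_ge0 t; rewrite !expr2; nra.
have qL : 1 - m%:R * s <= q^-1.
  rewrite /q -exprVn -mulrN (le_trans (@bernoulli_le _ (- s) m _))//; first lra.
  rewrite lerXn2r// ?nnegrE; [lra|by rewrite invr_ge0; lra|].
  rewrite -[X in _ <= X]mul1r ler_pdivlMr//.
  by have := sqr_ge0 s; rewrite expr2; nra.
have -> : (u + h) ^- m - u ^- m + h * (m%:R * u ^- m.+1) =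
    u ^- m * (q^-1 - (1 - m%:R * s)).
  rewrite (_ : u + h = u * (1 + s)); last by rewrite hE; ring.
  rewrite exprMn hE exprS -/q; field.
  by rewrite !gt_eqF// exprn_gt0.
have -> : (m%:R ^+ 2 *+ 2) * u ^- m.+2 * h ^+ 2 =
    u ^- m * ((m%:R * s) ^+ 2 *+ 2).
  rewrite hE !exprS; field.
  by rewrite !gt_eqF// exprn_gt0.
have w0 : 0 <= u ^- m by rewrite invr_ge0 exprn_ge0 ?ltW.
by rewrite -mulrN !ler_wpM2l//; have := sqr_ge0 (m%:R * s); lra.
Qed.

Definition hzeta_psum (R : realType) (m : nat) (x : R) (n : nat) : R :=
  \sum_(0 <= k < n) (x + k%:R) ^- m.

(** The Hurwitz zeta function at integer exponents. For [0 < x] the series converges from exponent 2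
    on, hence the form [m.+2] in the lemmas. *)
Definition hzeta (R : realType) (m : nat) (x : R) : R := limn (hzeta_psum m x).

Section Hzeta.
Context {R : realType}.
Implicit Types (x y : R) (m n : nat).

Lemma shift_gt0 x n : 0 < x -> 0 < x + n%:R.
Proof. by move=> x0; rewrite ltr_pwDl. Qed.

Lemma hzeta_psumS m x n :
  hzeta_psum m x n.+1 = hzeta_psum m x n + (x + n%:R) ^- m.
Proof. by rewrite /hzeta_psum big_nat_recr. Qed.

(** The bound is independent of [n]: it yields both convergence and the uniform constants of the
    Taylor estimates. *)
Lemma hzeta_psum_le m x n : 0 < x ->
  hzeta_psum m.+2 x n <= x ^- m * (x ^- 2 + x^-1).
Proof.
(* The subtracted [(x + k%:R)^-1] makes the induction go through: [(u + 1) ^- 2] is at most the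
   telescoping difference [u^-1 - (u + 1)^-1]. *)
move=> x0; have H2 k : hzeta_psum 2 x k.+1 <= x ^- 2 + x^-1 - (x + k%:R)^-1.
  elim: k => [|k IH]; first by rewrite hzeta_psumS /hzeta_psum big_nil addr0; lra.
  rewrite hzeta_psumS (le_trans (lerD IH (lexx _)))// -natr1.
  have := shift_gt0 k x0; set u := x + k%:R => u0.
  have -> : x + (k%:R + 1) = u + 1 by rewrite addrA.
  have : (u + 1) ^- 2 <= u^-1 - (u + 1)^-1; last lra.
  have -> : u^-1 - (u + 1)^-1 = (u * (u + 1))^-1 by field; rewrite !gt_eqF; lra.
  rewrite lef_pV2 ?posrE; [nra|by rewrite exprn_gt0// addr_gt0|].
  by rewrite mulr_gt0 // addr_gt0.
have H : hzeta_psum m.+2 x n <= x ^- m * hzeta_psum 2 x n.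
  rewrite /hzeta_psum big_distrr/=; apply: ler_sum => k _.
  have u0 := shift_gt0 k x0.
  rewrite -addn2 exprD invfM ler_wpM2r//; first by rewrite invr_ge0 exprn_ge0 ?ltW.
  rewrite lef_pV2 ?posrE ?exprn_gt0//.
  by rewrite lerXn2r// ?nnegrE; [lra|lra|rewrite lerDl].
apply: (le_trans H); rewrite ler_wpM2l//; first by rewrite invr_ge0 exprn_ge0 ?ltW.
case: n {H} => [|n].
  by rewrite /hzeta_psum big_nil; rewrite addr_ge0 ?invr_ge0 ?exprn_ge0 ?ltW.
by rewrite (le_trans (H2 n))// gerBl invr_ge0 ltW// shift_gt0.
Qed.

Lemma cvg_hzeta m x : 0 < x -> hzeta_psum m.+2 x @ \oo --> hzeta m.+2 x.
Proof.
move=> x0; apply: nondecreasing_is_cvgn.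
  apply/nondecreasing_seqP => n; rewrite hzeta_psumS lerDl invr_ge0 exprn_ge0//.
  by rewrite ltW// shift_gt0.
by exists (x ^- m * (x ^- 2 + x^-1)) => _ [n _ <-]; exact: hzeta_psum_le.
Qed.

Lemma hzeta_ge m x : 0 < x -> x ^- m.+2 <= hzeta m.+2 x.
Proof.
move=> x0; apply: (@ler_cvgn _ (fun=> x ^- m.+2)); [exact: cvg_cst|exact: cvg_hzeta|].
exists 1%N => // -[//|n] _ /=; rewrite /hzeta_psum big_nat_recl//= addr0 lerDl.
by apply: sumr_ge0 => k _; rewrite invr_ge0 exprn_ge0// ltW// shift_gt0.
Qed.

Lemma hzeta_gt0 m x : 0 < x -> 0 < hzeta m.+2 x.
Proof.
by move=> x0; rewrite (lt_le_trans _ (hzeta_ge m x0))// invr_gt0 exprn_gt0.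
Qed.

(** Sum of [exprVn_taylor] over the terms. The constant is uniform in [n] even for [m = 1], where
    the sums themselves diverge; [is_derive_digam] relies on that case. *)
Lemma hzeta_psum_taylor m x h n : 0 < x -> (m.+1%:R *+ 2) * `|h| <= x ->
  `|hzeta_psum m x n - hzeta_psum m (x + h) n - h * (m%:R * hzeta_psum m.+1 x n)|
     <= (m%:R ^+ 2 *+ 2) * (x ^- m * (x ^- 2 + x^-1)) * h ^+ 2.
Proof.
move=> x0 hx.
have -> : hzeta_psum m x n - hzeta_psum m (x + h) n
    - h * (m%:R * hzeta_psum m.+1 x n) =
    - \sum_(0 <= k < n) ((x + k%:R + h) ^- m - (x + k%:R) ^- m
        + h * (m%:R * (x + k%:R) ^- m.+1)).
  rewrite big_split/= sumrB -!mulr_sumr /hzeta_psum.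
  under [X in _ = - (X - _ + _)]eq_bigr do rewrite addrAC.
  ring.
rewrite normrN (le_trans (ler_norm_sum _ _ _))//.
apply: (@le_trans _ _ (\sum_(0 <= k < n)
   ((m%:R ^+ 2 *+ 2) * (x + k%:R) ^- m.+2 * h ^+ 2))).
  apply: ler_sum => k _; apply: exprVn_taylor; first exact: shift_gt0.
  by rewrite (le_trans hx)// lerDl.
rewrite -mulr_suml -mulr_sumr ler_wpM2r ?sqr_ge0// ler_wpM2l ?mulrn_wge0 ?sqr_ge0//.
exact: hzeta_psum_le.
Qed.

Lemma is_derive_hzeta m x : 0 < x ->
  is_derive x 1 (hzeta m.+2) (- (m.+2%:R * hzeta m.+3 x)).
Proof.
(* Within this radius [hzeta_psum_taylor] applies with exponent [m.+2], and [x + h] stays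
   positive. *)
move=> x0; pose r := x / (m.+3%:R *+ 2).
have d0 : 0 < m.+3%:R *+ 2 :> R by rewrite pmulrn_lgt0.
have hr h : `|h| < r -> (m.+3%:R *+ 2) * `|h| <= x.
  by rewrite /r ltr_pdivlMr// mulrC => /ltW.
have hr' h : `|h| < r -> 0 < x + h.
  move=> /hr; have : (3%:R *+ 2) * `|h| <= (m.+3%:R *+ 2) * `|h|.
    by rewrite ler_wpM2r// lerMn2r/= ler_nat.
  by move=> h6 hx; have := ler_norm (- h); rewrite normrN => ?; have := normr_ge0 h; lra.
apply: (@is_derive_limn _ _ (fun n y => hzeta_psum m.+2 y n)
  (fun n => - (m.+2%:R * hzeta_psum m.+3 x n)) (fun=> 0) x _
  ((m.+2%:R ^+ 2 *+ 2) * (x ^- m.+2 * (x ^- 2 + x^-1))) r).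
- by rewrite divr_gt0.
- by move=> h /hr' xh; exact: cvg_hzeta.
- by apply: cvgN; apply: cvgMr; exact: cvg_hzeta.
- exact: cvg_cst.
- move=> h /hr hx; near=> n; rewrite mulr0 add0r.
  have := hzeta_psum_taylor n x0 hx; congr (_ <= _).
  by rewrite -normrN; congr (`| _ |); ring.
Unshelve. all: by end_near. Qed.

End Hzeta.

(** * Logarithmic derivative of a log-convex solution of the functional equation of Gamma *)

Section Digamma.
Context {R : realType}.
Implicit Types (x y z h : R) (n : nat).

Lemma ln_sub_le x y : 0 < x -> 0 < y -> ln y - ln x <= (y - x) / x.
Proof.
move=> x0 y0; have -> : (y - x) / x = y / x - 1 by field; rewrite gt_eqF.
rewrite -ln_div ?posrE//.
have := @le_ln1Dx R (y / x - 1); rewrite addrCA subrr addr0; apply.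
by have := divr_gt0 y0 x0; lra.
Qed.

(** Tangents at [x] and at [x + h] enclose the increment of [ln] between [h / (x + h)] and
    [h / x]. *)
Lemma ln_taylor x h : 0 < x -> 2 * `|h| <= x ->
  `|ln (x + h) - ln x - h / x| <= 2 * x ^- 2 * h ^+ 2.
Proof.
move=> x0 hx; have := ler_norm h; have := ler_norm (- h); rewrite normrN => hl hu.
have xh0 : 0 < x + h by lra.
have := ln_sub_le x0 xh0; have := ln_sub_le xh0 x0.
rewrite (_ : x + h - x = h) 1?(_ : x - (x + h) = - h); [|ring|ring].
move=> L U; rewrite ler_norml; apply/andP; split; last first.
  have : 0 <= 2 * x ^- 2 * h ^+ 2; last lra.
  by rewrite mulr_ge0 ?sqr_ge0// mulr_ge0 ?invr_ge0 ?sqr_ge0.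
have : h / x - h / (x + h) <= 2 * x ^- 2 * h ^+ 2; last lra.
have -> : h / x - h / (x + h) = h ^+ 2 / (x * (x + h)).
  by field; rewrite !gt_eqF.
rewrite mulrC ler_wpM2r ?sqr_ge0// -[2]invrK -invfM lef_pV2 ?posrE ?mulr_gt0//.
by rewrite expr2; nra.
Qed.

(** With [ln (x + n%:R)] in place of the customary [ln n%:R], the sequence is nonincreasing and its
    main term is the approximate slope at [x + n%:R] of a convex solution [f]. *)
Definition digam_psum x n : R := ln (x + n%:R) - hzeta_psum 1 x n.

Definition digam x : R := limn (digam_psum x).

Lemma cvg_digam x : 0 < x -> digam_psum x @ \oo --> digam x.
Proof.
move=> x0.
have S n : digam_psum x n.+1 - digam_psum x n =
    ln (x + n%:R + 1) - ln (x + n%:R) - (x + n%:R)^-1.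
  by rewrite /digam_psum hzeta_psumS -natr1 addrA expr1; ring.
apply: nonincreasing_is_cvgn.
  apply/nonincreasing_seqP => n; rewrite -subr_le0 S.
  have u0 := shift_gt0 n x0.
  have := @ln_sub_le (x + n%:R) (x + n%:R + 1) u0.
  by rewrite (addrAC _ 1) subrr add0r div1r => /(_ ltac:(lra)); lra.
exists (ln x - x^-1) => _ [n _ <-].
(* Lower bound by a companion sequence: [digam_psum x n - (x + n%:R)^-1] is nondecreasing in [n]. *)
have : ln x - x^-1 + (x + n%:R)^-1 <= digam_psum x n.
  elim: n => [|n]; first by rewrite /digam_psum /hzeta_psum big_nil addr0; lra.
  have := S n; rewrite -natr1 addrA; have := shift_gt0 n x0.
  set u := x + n%:R => u0.
  have u1 : 0 < u + 1 by lra.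
  have := @ln_sub_le (u + 1) u u1 u0.
  by rewrite (_ : u - (u + 1) = -1) ?mulN1r; [lra|ring].
by have : 0 < (x + n%:R)^-1; [rewrite invr_gt0 shift_gt0|lra].
Qed.

Lemma cvg_invDn x : (x + n%:R)^-1 @[n --> \oo] --> 0.
Proof.
apply/gtr0_cvgV0.
  near=> n; rewrite addrC -ltrBlDr sub0r; near: n; exact: nbhs_infty_gtr.
apply/cvgryPge => A; near=> n; rewrite addrC -lerBlDr; near: n.
exact: nbhs_infty_ger.
Unshelve. all: by end_near. Qed.

Lemma is_derive_digam x : 0 < x -> is_derive x 1 digam (hzeta 2 x).
Proof.
move=> x0.
apply: (@is_derive_limn _ _ (fun n y => digam_psum y n) (hzeta_psum 2 x)
  (fun n => 2 * (x + n%:R)^-1) x _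
  ((1%:R ^+ 2 *+ 2) * (x ^- 1 * (x ^- 2 + x^-1))) (x / 4)).
- by rewrite divr_gt0.
- move=> h hx; apply: cvg_digam.
  have := ler_norm (- h); rewrite normrN; lra.
- exact: cvg_hzeta.
- by rewrite -[X in _ --> X](mulr0 2); apply: cvgMr; exact: cvg_invDn.
- move=> h hx; near=> n.
  (* The logarithmic increment is at most [2 / (x + n%:R)] times the modulus of [h] and goes into
     [eps]; the rest is a Taylor remainder of order [h ^+ 2]. *)
  have -> : digam_psum (x + h) n - digam_psum x n - h * hzeta_psum 2 x n =
    (ln (x + n%:R + h) - ln (x + n%:R)) +
    (hzeta_psum 1 x n - hzeta_psum 1 (x + h) n - h * (1%:R * hzeta_psum 2 x n)).
    by rewrite /digam_psum (addrAC x h); ring.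
  rewrite (le_trans (ler_normD _ _))// lerD//; last first.
    by apply: hzeta_psum_taylor => //; lra.
  have u0 := shift_gt0 n x0; have xu : x <= x + n%:R by rewrite lerDl.
  have := @ln_taylor (x + n%:R) h u0.
  set u := x + n%:R in u0 xu *; set w := ln (u + h) - ln u => /(_ ltac:(lra)) wb.
  have -> : w = (w - h / u) + h / u by ring.
  rewrite (le_trans (ler_normD _ _))// (le_trans (lerD wb (lexx _)))//.
  rewrite normrM normfV (gtr0_norm u0) -(real_normK (num_real h)).
  rewrite -subr_ge0.
  have -> : `|h| * (2 * u^-1) - (2 * u ^- 2 * `|h| ^+ 2 + `|h| / u) =
     `|h| * u ^- 2 * (u - 2 * `|h|) by field; rewrite gt_eqF.
  by rewrite !mulr_ge0 ?invr_ge0 ?sqr_ge0//; lra.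
Unshelve. all: by end_near. Qed.

(** * Convex solutions of the logarithmic functional equation (the Bohr-Mollerup setting) *)

Section convex_log_gamma.
Variable f : R -> R.
Hypothesis f1 : forall x, 0 < x -> f (x + 1) = f x + ln x.
Hypothesis fconv : forall x y t, 0 < x -> 0 < y -> 0 <= t <= 1 ->
  f (t * x + (1 - t) * y) <= t * f x + (1 - t) * f y.

(** Convexity makes chord slopes monotone, and the functional equation gives the slopes over
    [[z - 1, z]] and [[z, z + 1]] as [ln (z - 1)] and [ln z]. The two bounds write [z] as a mean of
    [z - 1] and [z + h], and [z + h] as a mean of [z] and [z + 1]. *)
Let slope z h : 1 < z -> 0 <= h <= 1 ->
  h * ln (z - 1) <= f (z + h) - f z <= h * ln z.
Proof.
move=> z1 /andP[h0 h1]; apply/andP; split.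
  have zh0 : 0 < z + h by lra.
  have z10 : 0 < z - 1 by lra.
  have := @fconv (z - 1) (z + h) (h / (1 + h)) z10 zh0.
  rewrite divr_ge0 ?ler_pdivrMr ?mul1r; [|lra..].
  have -> : h / (1 + h) * (z - 1) + (1 - h / (1 + h)) * (z + h) = z.
    by field; lra.
  have := f1 z10; rewrite subrK => -> /(_ ltac:(lra)) H.
  have h10 : 0 < 1 + h by lra.
  have := ler_wpM2r (ltW h10) H.
  have -> : (h / (1 + h) * f (z - 1) + (1 - h / (1 + h)) * f (z + h)) * (1 + h) =
    h * f (z - 1) + f (z + h) by field; lra.
  lra.
have z0 : 0 < z by lra.
have z10 : 0 < z + 1 by lra.
have := @fconv (z + 1) z h z10 z0; rewrite h0 h1 f1// => /(_ isT).
have -> : h * (z + 1) + (1 - h) * z = z + h by ring.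
lra.
Qed.

(** For negative [h], [slope] is applied at [z + h], whose lower slope is at least [ln (z - 2)];
    hence the [z - 2]. *)
Let increment z h : 2 < z -> `|h| <= 1 ->
  `|f (z + h) - f z - h * ln z| <= `|h| * (2 * (z - 2)^-1).
Proof.
move=> z2 hh.
have zz : ln z - ln (z - 2) <= 2 * (z - 2)^-1.
  have := @ln_sub_le (z - 2) z; rewrite (_ : z - (z - 2) = 2); last ring.
  by apply; lra.
have lnle (a b : R) : 0 < a -> a <= b -> ln a <= ln b.
  by move=> a0 ab; rewrite ler_ln ?posrE//; lra.
have [h0|h0] := leP 0 h.
  rewrite (ger0_norm h0) in hh *.
  have := @slope z h; rewrite h0 hh => /(_ ltac:(lra) isT)/andP[L U].
  rewrite ler0_norm; last lra.
  have := lnle (z - 2) (z - 1) ltac:(lra) ltac:(lra); nra.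
rewrite (ltr0_norm h0) in hh *.
have := @slope (z + h) (- h) ltac:(lra).
rewrite addrK hh oppr_ge0 (ltW h0) => /(_ isT)/andP[L U].
have l1 := lnle (z - 2) (z + h - 1) ltac:(lra) ltac:(lra).
have l2 := lnle (z + h) z ltac:(lra) ltac:(lra).
by rewrite ger0_norm; nra.
Qed.

Let iterE x n : 0 < x -> f (x + n%:R) = f x + \sum_(0 <= k < n) ln (x + k%:R).
Proof.
move=> x0; elim: n => [|n IH]; first by rewrite big_nil !addr0.
by rewrite -natr1 addrA f1 ?shift_gt0// IH big_nat_recr//= addrA.
Qed.

(** The functional equation transports the increment of [f] from [x] to [x + n%:R], where
    [increment] controls it with vanishing error; the logarithms picked up on the way have quadratic
    Taylor remainders. [is_derive_limn] is applied to a constant sequence of functions, only the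
    slopes varying with [n]. *)
Lemma is_derive_convex_log_gamma x : 0 < x -> is_derive x 1 f (digam x).
Proof.
(* The bound 1 serves [increment]; [x / 4] serves [ln_taylor] and the positivity of [x + h]. *)
move=> x0; pose r := Num.min 1 (x / 4).
have hr1 h : `|h| < r -> `|h| <= 1 by rewrite lt_min => /andP[/ltW].
have hrx h : `|h| < r -> `|h| <= x / 4 by rewrite lt_min => /andP[_ /ltW].
apply: (@is_derive_limn _ _ (fun=> f) (digam_psum x)
  (fun n => 2 * (x - 2 + n%:R)^-1) x _ (2 * (x ^- 0 * (x ^- 2 + x^-1))) r).
- by rewrite lt_min ltr01 divr_gt0.
- by move=> h _; exact: cvg_cst.
- exact: cvg_digam.
- by rewrite -[X in _ --> X](mulr0 2); apply: cvgMr; exact: cvg_invDn.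
- move=> h hr; near=> n.
  have xh0 : 0 < x + h.
    by have := ler_norm (- h); rewrite normrN; have := hrx _ hr; lra.
  have -> : f (x + h) - f x - h * digam_psum x n =
    (f (x + n%:R + h) - f (x + n%:R) - h * ln (x + n%:R)) -
    \sum_(0 <= k < n) (ln (x + k%:R + h) - ln (x + k%:R) - h / (x + k%:R)).
    rewrite (addrAC x _ h) !iterE// !sumrB -mulr_sumr /digam_psum /hzeta_psum.
    under [X in _ = _ - (X - _ - _)]eq_bigr do rewrite addrAC.
    by under [X in h * (_ - X)]eq_bigr do rewrite expr1; ring.
  rewrite (le_trans (ler_normB _ _))// lerD//.
    have -> : x - 2 + n%:R = (x + n%:R) - 2 by ring.
    apply: increment; last exact: hr1.
    have : 2 <= n%:R :> R by near: n; exact: nbhs_infty_ger.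
    lra.
  rewrite (le_trans (ler_norm_sum _ _ _))//.
  rewrite -mulrA.
  apply: (@le_trans _ _ (2 * (hzeta_psum 2 x n * h ^+ 2))).
    rewrite /hzeta_psum mulr_suml mulr_sumr; apply: ler_sum => k _.
    rewrite mulrA; apply: ln_taylor; first exact: shift_gt0.
    have : 0 <= k%:R :> R by []. 
    by have := hrx _ hr; have := normr_ge0 h; lra.
  by rewrite ler_wpM2l// ler_wpM2r ?sqr_ge0// hzeta_psum_le.
Unshelve. all: by end_near. Qed.

End convex_log_gamma.
End Digamma.

(** * The Gamma integral *)

Section Gamma_integral.
Context {R : realType}.
Notation mu := (@lebesgue_measure R).
Implicit Types (x y t : R).

Lemma is_derive_continuous (f : R -> R) x d :
  is_derive x 1 f d -> {for x, continuous f}.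
Proof. by case=> /derivable1_diffP/differentiable_continuous. Qed.

Lemma is_derive_LRcontinuous (f df : R -> R) (a b : R) :
  (forall x, a <= x <= b -> is_derive x 1 f (df x)) -> a <= b ->
  derivable_oo_LRcontinuous f a b.
Proof.
move=> fE ab; split.
- by move=> x; rewrite in_itv/= => /andP[/ltW ax /ltW xb]; case: (fE x); rewrite ?ax.
- by apply: cvg_at_right_filter; apply: (is_derive_continuous (fE a _)); rewrite lexx.
- by apply: cvg_at_left_filter; apply: (is_derive_continuous (fE b _)); rewrite lexx andbT.
Qed.

Definition gamma_integrand x t : R := t `^ (x - 1) * expR (- t).

Lemma gamma_integrand_ge0 x t : 0 <= gamma_integrand x t.
Proof. by rewrite mulr_ge0 ?powR_ge0 ?expR_ge0. Qed.

Lemma is_derive_expRN t : is_derive t 1 (fun s => expR (- s)) (- expR (- t)).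
Proof.
by apply: is_derive_eq; rewrite mulrN1.
Qed.

Lemma continuous_gamma_integrand x t : 0 < t ->
  {for t, continuous (gamma_integrand x)}.
Proof.
move=> t0; apply: cvgM.
  exact: (is_derive_continuous (is_derive1_powR _ t0)).
exact: (is_derive_continuous (is_derive_expRN t)).
Qed.

Lemma measurable_gamma_integrand x (D : set R) : measurable D ->
  D `<=` `]0, +oo[ -> measurable_fun D (gamma_integrand x).
Proof.
move=> mD D0; apply: (measurable_funS _ D0) => //.
apply: open_continuous_measurable_fun; first exact: interval_open.
by move=> t /[!inE]/=; rewrite in_itv/= andbT; exact: continuous_gamma_integrand.
Qed.

(** Extended real values allow monotone convergence and the functional equation before finiteness is
    known; finiteness is then deduced from that equation. *)
Definition Gamma_ereal x : \bar R :=
  (\int[mu]_(t in `]0%R, +oo[) (gamma_integrand x t)%:E)%E.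

Lemma Gamma_ereal_ge0 x : (0 <= Gamma_ereal x)%E.
Proof. by apply: integral_ge0 => t _; rewrite lee_fin gamma_integrand_ge0. Qed.

(** Compact exhaustion of the half-line, away from the singularity at 0. The shift to [n.+2] keeps
    every interval nondegenerate, as integration by parts demands. *)
Let box n : set R := `[n.+2%:R^-1, n.+2%:R].

Let box_gt0 n t : box n t -> 0 < t.
Proof. by rewrite /box/= in_itv/= => /andP[+ _]; apply: lt_le_trans; rewrite invr_gt0. Qed.

Let bigcup_box : \bigcup_n box n = `]0, +oo[%classic.
Proof.
apply/seteqP; split=> [t [n _ /box_gt0 t0]|t /=]; rewrite /= in_itv/= andbT// => t0.
pose n := (Num.truncn (Num.max t t^-1)); exists n => //; rewrite /box/= in_itv/=.
have : Num.max t t^-1 <= n.+2%:R.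
  by rewrite (le_trans (ltW (truncnS_gt _)))// ler_nat.
rewrite ge_max => /andP[-> tn]; rewrite andbT.
by rewrite -[t]invrK lef_pV2// posrE ?invr_gt0.
Qed.

Lemma cvg_Gamma_box x :
  (\int[mu]_(t in box n) (gamma_integrand x t)%:E)%E @[n --> \oo] -->
  Gamma_ereal x.
Proof.
rewrite /Gamma_ereal -bigcup_box.
apply: ge0_nondecreasing_set_cvg_integral => //.
- apply/nondecreasing_seqP => n; apply/subsetPset => t.
  rewrite /box/= !in_itv/= => /andP[nt tn]; apply/andP; split.
    by rewrite (le_trans _ nt)// lef_pV2 ?posrE// ler_nat.
  by rewrite (le_trans tn)// ler_nat.
- by move=> n; exact: measurable_itv.
- move=> n; apply/measurable_EFinP.
  apply: measurable_gamma_integrand; first exact: measurable_itv.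
  by move=> t /box_gt0; rewrite /= in_itv/= andbT.
- by move=> n t _; rewrite lee_fin gamma_integrand_ge0.
Qed.

Lemma Gamma_by_parts x n : 0 <= x ->
  ((x%:E * \int[mu]_(t in box n) (gamma_integrand x t)%:E) =
  (n.+2%:R `^ x * expR (- n.+2%:R) -
    n.+2%:R^-1 `^ x * expR (- n.+2%:R^-1))%:E +
  \int[mu]_(t in box n) (gamma_integrand (x + 1) t)%:E)%E.
Proof.
move=> x0; rewrite /box; set a := n.+2%:R^-1; set b := n.+2%:R.
have b1 : 1 < b by rewrite ltr1n.
have a0 : 0 < a by rewrite invr_gt0 (lt_trans _ b1).
have ab : a < b by rewrite (le_lt_trans _ b1)// invf_le1 ?ltW// (lt_trans _ b1).
have pos t : a <= t <= b -> 0 < t by move=> /andP[/(lt_le_trans a0)].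
have dF t : a <= t <= b -> is_derive t 1 (@powR R ^~ x) (x * t `^ (x - 1)).
  by move=> /pos t0; exact: is_derive1_powR.
have dG t : a <= t <= b -> is_derive t 1 (fun t => - expR (- t)) (expR (- t)).
  by move=> _; have ? := is_derive_expRN t; apply: is_derive_eq; rewrite opprK.
have := @integration_by_parts R (@powR R ^~ x) (fun t => - expR (- t))
  (fun t => x * t `^ (x - 1)) (fun t => expR (- t)) a b ab.
move=> /(_ _ (is_derive_LRcontinuous dF (ltW ab)) _ _ (is_derive_LRcontinuous dG (ltW ab)) _) H.
rewrite {2}/gamma_integrand addrK H.
- under [X in (_ - X)%E]eq_integral => t _.
    rewrite (_ : _%:E = (- (x%:E * (gamma_integrand x t)%:E))%E); last first.
      by rewrite /gamma_integrand -EFinM -EFinN; congr EFin; ring.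
    over.
  rewrite integral_ge0N/=; last first.
    by move=> t _; rewrite -EFinM lee_fin mulr_ge0// gamma_integrand_ge0.
  rewrite ge0_integralZl_EFin//=.
  + rewrite oppeK addeA -EFinD [X in (X%:E + _)%E](_ : _ = 0) ?add0e//; ring.
  + by move=> t _; rewrite lee_fin gamma_integrand_ge0.
  + apply/measurable_EFinP; apply: measurable_gamma_integrand => // t /=.
    by rewrite !in_itv/= andbT => /pos.
- apply: continuous_in_subspaceT => t /[!inE]/=; rewrite in_itv/= => /pos t0.
  apply: cvgM; first exact: cvg_cst.
  exact: (is_derive_continuous (is_derive1_powR _ t0)).
- move=> t; rewrite in_itv/= => /andP[/ltW ta /ltW tb].
  by rewrite derive1E; apply: derive_val; apply: dF; rewrite ta.
- apply: continuous_in_subspaceT => t _.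
  exact: (is_derive_continuous (is_derive_expRN t)).
- move=> t; rewrite in_itv/= => /andP[/ltW ta /ltW tb].
  by rewrite derive1E; apply: derive_val; apply: dG; rewrite ta.
Qed.

Lemma powR_expRN_le x : exists2 C, 0 <= C &
  forall t, 1 <= t -> t `^ x * expR (- t) <= C * t^-1.
Proof.
pose k := (Num.truncn `|x|).+1; exists k.+1`!%:R => // s s1.
have s0 : 0 < s by lra.
have xk : s `^ x <= s ^+ k.
  rewrite -powR_mulrn ?(ltW s0)// ler_powR// (le_trans (ler_norm _))//.
  exact: ltW (truncnS_gt _).
rewrite expRN (le_trans (ler_wpM2r _ xk)) ?invr_ge0 ?expR_ge0//.
rewrite ler_pdivrMr ?expR_gt0// mulrAC ler_pdivlMr// -exprSr mulrC.
rewrite -ler_pdivrMr ?ltr0n ?fact_gt0//.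
by have := expR_ge1Dxn k (ltW s0); lra.
Qed.

Lemma cvg_powR_expRN x :
  (n.+2%:R `^ x * expR (- n.+2%:R)) @[n --> \oo] --> (0 : R).
Proof.
have [C C0 CP] := powR_expRN_le x.
apply: (@squeeze_cvgr _ _ _ _ (fun=> 0) (fun n => C * (2 + n%:R)^-1)); last 2 first.
- exact: cvg_cst.
- by rewrite -[X in _ --> X](mulr0 C); apply: cvgMr; exact: cvg_invDn.
near=> n; rewrite mulr_ge0 ?powR_ge0 ?expR_ge0//= -natrD add2n CP//.
by rewrite ler1n.
Unshelve. all: by end_near. Qed.

Lemma cvg_powR_expRNV x : 0 < x ->
  (n.+2%:R^-1 `^ x * expR (- n.+2%:R^-1)) @[n --> \oo] --> (0 : R).
Proof.
move=> x0.
apply: (@squeeze_cvgr _ _ _ _ (fun=> 0) (fun n => n.+2%:R^-1 `^ x)); last 2 first.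
- exact: cvg_cst.
- have /cvg_at_rightP := powR_cvg0 x0; apply; split => //.
  under eq_fun do rewrite -add2n natrD.
  exact: cvg_invDn.
by near=> n; rewrite mulr_ge0 ?powR_ge0 ?expR_ge0//= ler_piMr ?powR_ge0.
Unshelve. all: by end_near. Qed.

(** Limit of [Gamma_by_parts] along the boxes: the boundary terms vanish at both ends. *)
Lemma Gamma_erealD1 x : 0 < x -> Gamma_ereal (x + 1) = (x%:E * Gamma_ereal x)%E.
Proof.
move=> x0; rewrite -(cvg_lim (@ereal_hausdorff R) (@cvg_Gamma_box (x + 1))).
have H : (x%:E * \int[mu]_(t in box n) (gamma_integrand x t)%:E +
   (- (n.+2%:R `^ x * expR (- n.+2%:R) -
    n.+2%:R^-1 `^ x * expR (- n.+2%:R^-1)))%:E)%E @[n --> \oo] -->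
   (x%:E * Gamma_ereal x + 0)%E.
  apply: cvgeD; first by rewrite fin_num_adde_defl.
    by apply: cvgeZl => //; exact: cvg_Gamma_box.
  apply: cvg_EFin; first by near=> n.
  rewrite -oppr0; apply: cvgN; rewrite -[X in _ --> X]subr0.
  by apply: cvgB; [exact: cvg_powR_expRN|exact: cvg_powR_expRNV].
rewrite adde0 in H; rewrite -(cvg_lim (@ereal_hausdorff R) H).
congr (lim (_ @ \oo)); apply/funext => n.
by rewrite Gamma_by_parts ?ltW// addeAC -EFinD subrr add0e.
Unshelve. all: by end_near. Qed.

End Gamma_integral.

(** * Finiteness, positivity, log-convexity and derivative of Gamma *)

Section Gamma_properties.
Context {R : realType}.
Notation mu := (@lebesgue_measure R).
Implicit Types (x y t : R).

Let measurable_gammaE x :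
  measurable_fun (`]0, +oo[%classic : set R) (fun t => (gamma_integrand x t)%:E).
Proof. by apply/measurable_EFinP; exact: measurable_gamma_integrand. Qed.

Let le_Gamma_integral x y z (a b : R) : 0 <= a -> 0 <= b ->
  (forall t, 0 < t ->
    gamma_integrand z t <= a * gamma_integrand x t + b * gamma_integrand y t) ->
  (Gamma_ereal z <= a%:E * Gamma_ereal x + b%:E * Gamma_ereal y)%E.
Proof.
move=> a0 b0 H; rewrite /Gamma_ereal.
have ge0 w t : (0 <= (gamma_integrand w t)%:E)%E.
  by rewrite lee_fin gamma_integrand_ge0.
rewrite -!ge0_integralZl_EFin//; try exact: measurable_gammaE.
rewrite -ge0_integralD//=; last 4 first.
- by move=> t _; rewrite mule_ge0.
- by apply: measurable_funeM; exact: measurable_gammaE.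
- by move=> t _; rewrite mule_ge0.
- by apply: measurable_funeM; exact: measurable_gammaE.
apply: ge0_le_integral => //=.
- exact: measurable_gammaE.
- by apply: emeasurable_funD; apply: measurable_funeM; exact: measurable_gammaE.
- move=> t; rewrite in_itv/= andbT => t0.
  by rewrite -!EFinM -EFinD lee_fin H.
Qed.

Let Gamma_ereal1_lty : (Gamma_ereal 1 < +oo :> \bar R)%E.
Proof.
have := @ge0_continuous_FTC2y R (fun t => expR (- t)) (fun t => - expR (- t)) 0 0.
have d t : is_derive t 1 (fun t => - expR (- t)) (expR (- t)).
  by have ? := @is_derive_expRN R t; apply: is_derive_eq; rewrite opprK.
move=> H; have {}H : (\int[mu]_(x in `[0%R, +oo[) (expR (- x))%:E)%E = 1%E.
  rewrite H ?oppr0 ?expR0 ?sub0e ?EFinN ?oppeK//.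
  - apply: continuous_in_subspaceT => t _.
    exact: (is_derive_continuous (is_derive_expRN t)).
  - by rewrite -oppr0; apply: cvgN; exact: cvgr_expR.
  - apply: cvg_at_right_filter; have := is_derive_continuous (d 0).
    by rewrite /prop_for/continuous_at oppr0 expR0.
  - by move=> t _; rewrite derive1E derive_val.
apply: (@le_lt_trans _ _ 1%E); last exact: ltry.
rewrite -H /Gamma_ereal; under eq_integral => t _.
  by rewrite /gamma_integrand subrr powRr0 mul1r; over.
apply: ge0_subset_integral => //=.
- apply/measurable_EFinP; apply: measurable_funTS; apply: continuous_measurable_fun.
  by move=> t; exact: (is_derive_continuous (is_derive_expRN t)).
- by move=> t /=; rewrite !in_itv/= !andbT => /ltW.
Qed.

(** Positive integers follow from the value 1 by the functional equation. For [1 <= y] the integrand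
    is dominated by the sum of those at 1 and at an integer above [y]. Any [0 < x] is then reached
    from [x + 1], since an infinite value at [x] would propagate. *)
Lemma Gamma_ereal_lty x : 0 < x -> (Gamma_ereal x < +oo)%E.
Proof.
have In n : (Gamma_ereal (n.+1%:R : R) < +oo)%E.
  elim: n => [//|n IH]; rewrite -natr1 Gamma_erealD1//.
  by rewrite lte_mul_pinfty// ?lee_fin.
have I1 y : 1 <= y -> (Gamma_ereal y < +oo)%E.
  move=> y1; set n := Num.truncn y.
  apply: (@le_lt_trans _ _ (1%:E * Gamma_ereal 1 + 1%:E * Gamma_ereal n.+1%:R)%E).
    apply: le_Gamma_integral => // t t0; rewrite !mul1r /gamma_integrand -mulrDl.
    rewrite ler_wpM2r ?expR_ge0// subrr powRr0.
    have [t1|t1] := leP t 1.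
      rewrite (@le_trans _ _ 1) ?lerDl ?powR_ge0//.
      rewrite -[X in _ <= X](powRr0 t) ger_powR ?t0//; lra.
    rewrite (@le_trans _ _ (t `^ (n.+1%:R - 1))) ?lerDr//.
    by rewrite ler_powR ?(ltW t1)// lerD2r ltW// truncnS_gt.
  by rewrite !mul1e lte_add_pinfty.
move=> x0; have /I1 : 1 <= x + 1 by lra.
rewrite Gamma_erealD1//; have := Gamma_ereal_ge0 x.
by case: (Gamma_ereal x) => [r _ _|_|//]; rewrite ?ltry// gt0_muley ?lte_fin.
Qed.

Lemma EFin_Gamma x : 0 < x -> (Gamma x)%:E = Gamma_ereal x.
Proof.
move=> x0; rewrite /Gamma /Rintegral fineK// ge0_fin_numE; last exact: Gamma_ereal_ge0.
exact: Gamma_ereal_lty.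
Qed.

Lemma GammaD1 x : 0 < x -> Gamma (x + 1) = x * Gamma x.
Proof.
move=> x0; apply: EFin_inj; rewrite EFinM !EFin_Gamma// ?Gamma_erealD1//.
by rewrite addr_gt0.
Qed.

Lemma Gamma_gt0 x : 0 < x -> 0 < Gamma x.
Proof.
move=> x0; rewrite -lte_fin EFin_Gamma//.
(* On [[1, 2]] the power [x - 1] of [t] is at least [t^-1 >= 1/2], and the exponential is at least
   [expR (-2)]. *)
have c0 : 0 < expR (-2) / 2 :> R by rewrite divr_gt0 ?expR_gt0.
apply: (@lt_le_trans _ _ (\int[mu]_(t in `[1%R, 2%R]) (expR (-2) / 2)%:E)%E).
  rewrite integral_cst//= lebesgue_measure_itv/= lte_fin ltr1n/= -EFinB -EFinM.
  by rewrite lte_fin mulr_gt0//; lra.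
apply: (@le_trans _ _ (\int[mu]_(t in `[1%R, 2%R]) (gamma_integrand x t)%:E)%E).
  apply: ge0_le_integral => //=.
  - apply: measurable_funS (measurable_gammaE x) => //.
    by move=> t /=; rewrite !in_itv/= andbT => /andP[t1 _]; lra.
  - move=> t; rewrite in_itv/= => /andP[t1 t2]; rewrite lee_fin /gamma_integrand.
    rewrite powRB ?powRr1; [|lra|by apply/implyP => _; rewrite gt_eqF//; lra].
    rewrite mulrC ler_pM ?expR_ge0 ?ler_expR//; last lra.
    rewrite -[X in X <= _]mul1r ler_pM//; last by rewrite lef_pV2 ?posrE//; lra.
    by rewrite -(powRr0 t) ler_powR// ltW.
apply: ge0_subset_integral => //=.
- exact: measurable_gammaE.
- by move=> t _; rewrite lee_fin gamma_integrand_ge0.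
- by move=> t /=; rewrite !in_itv/= andbT => /andP[t1 _]; lra.
Qed.

(** Average at [x] and [y] the tangent inequality of [expR] taken at the mean point [w]. *)
Lemma expR_convex t x y : 0 <= t <= 1 ->
  expR (t * x + (1 - t) * y) <= t * expR x + (1 - t) * expR y.
Proof.
move=> /andP[t0 t1]; set w := t * x + (1 - t) * y.
have E z : expR w * (1 + (z - w)) <= expR z.
  have -> : expR z = expR w * expR (z - w) by rewrite -expRD; congr expR; ring.
  by rewrite ler_wpM2l ?expR_ge0// expR_ge1Dx.
have := ler_wpM2l t0 (E x); have t1' : 0 <= 1 - t by lra.
have := ler_wpM2l t1' (E y); have := expR_gt0 w.
have -> : t * (expR w * (1 + (x - w))) =
  expR w - (1 - t) * (expR w * (1 + (y - w))) by rewrite /w; ring.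
lra.
Qed.

(** The proof of Hölder's inequality: the integrands at [x] and [y], divided by their integrals [p]
    and [q], are compared pointwise by convexity of [expR], then integrated. [K] is the weighted
    geometric mean of [p] and [q]. *)
Lemma ln_Gamma_convex x y t : 0 < x -> 0 < y -> 0 <= t <= 1 ->
  ln (Gamma (t * x + (1 - t) * y)) <= t * ln (Gamma x) + (1 - t) * ln (Gamma y).
Proof.
move=> x0 y0 /[dup] t01 /andP[t0 t1].
set z := t * x + (1 - t) * y.
have z0 : 0 < z.
  have [tE|tn0] := eqVneq t 0; first by rewrite /z tE mul0r subr0 mul1r add0r.
  have tgt0 : 0 < t by rewrite lt_neqAle eq_sym tn0.
  by rewrite ltr_pwDl ?mulr_gt0// mulr_ge0 ?subr_ge0// ltW.
have p0 := Gamma_gt0 x0; have q0 := Gamma_gt0 y0.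
set p := Gamma x in p0 *; set q := Gamma y in q0 *.
pose K := expR (t * ln p + (1 - t) * ln q).
rewrite -[X in _ <= X]expRK -/K ler_ln ?posrE ?expR_gt0 ?Gamma_gt0//.
rewrite -lee_fin EFin_Gamma//.
have K0 : 0 < K by exact: expR_gt0.
have -> : K%:E = ((K * t / p)%:E * Gamma_ereal x +
    (K * (1 - t) / q)%:E * Gamma_ereal y)%E.
  rewrite -!EFin_Gamma// -/p -/q -!EFinM -EFinD; congr EFin; field.
  by rewrite !gt_eqF.
apply: le_Gamma_integral.
- by rewrite divr_ge0 ?mulr_ge0// ltW.
- by rewrite divr_ge0 ?mulr_ge0 ?subr_ge0// ltW.
move=> s s0.
have gE w : gamma_integrand w s = expR ((w - 1) * ln s - s).
  by rewrite /gamma_integrand /powR gt_eqF// -expRD.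
have := @expR_convex t ((x - 1) * ln s - s - ln p) ((y - 1) * ln s - s - ln q) t01.
have -> : t * ((x - 1) * ln s - s - ln p) + (1 - t) * ((y - 1) * ln s - s - ln q)
   = ((z - 1) * ln s - s) - (t * ln p + (1 - t) * ln q) by rewrite /z; ring.
rewrite !(expRB (_ - s)) -!gE !lnK ?posrE// -/K ler_pdivrMr//.
congr (_ <= _); ring.
Qed.

(** Differentiability comes from log-convexity, through [ln], instead of differentiation under the
    integral sign. *)
Lemma is_derive_Gamma x : 0 < x -> is_derive x 1 (@Gamma R) (digam x * Gamma x).
Proof.
move=> x0.
have lnG : is_derive x 1 (fun y => ln (Gamma y)) (digam x).
  apply: is_derive_convex_log_gamma => //.
  - move=> y y0; rewrite GammaD1// lnM ?posrE ?Gamma_gt0//; exact: addrC.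
  - exact: ln_Gamma_convex.
apply: (@near_eq_is_derive _ _ _ (fun y => expR (ln (Gamma y)))).
  by near=> y; rewrite lnK// posrE Gamma_gt0//; near: y; exact: lt_nbhsr.
by apply: is_derive_eq; rewrite lnK ?posrE ?Gamma_gt0//; exact: mulrC.
Unshelve. all: by end_near. Qed.

Lemma psiE x : 0 < x -> psi x = digam x.
Proof.
move=> x0; rewrite /psi derive1E; have ? := is_derive_Gamma x0.
by rewrite derive_val mulfK// gt_eqF// Gamma_gt0.
Qed.

End Gamma_properties.

(** * Polygamma functions *)

Section Polygamma.
Context {R : realType}.
Implicit Types (x a b beta : R) (i k n : nat).

(** Agreement with [G n] on the positive reals, an open set, is agreement near each of its points,
    which determines the next derivative. *)
Lemma derive1n_pos (f : R -> R) (G : nat -> R -> R) :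
  (forall x, 0 < x -> f x = G 0 x) ->
  (forall n x, 0 < x -> is_derive x 1 (G n) (G n.+1 x)) ->
  forall n x, 0 < x ->
    f^`(n) x = G n x /\ is_derive x 1 f^`(n) (G n.+1 x).
Proof.
move=> fG0 dG.
have D g n : (forall x, 0 < x -> g x = G n x) ->
    forall x, 0 < x -> is_derive x 1 g (G n.+1 x).
  move=> gG x x0; apply: near_eq_is_derive (dG n x x0).
  by near=> y; rewrite gG//; near: y; exact: lt_nbhsr.
have E n : forall x, 0 < x -> f^`(n) x = G n x.
  elim: n => [//|n IH] x x0; rewrite derive1nS derive1E.
  by have ? := D _ _ IH x x0; rewrite derive_val.
by move=> n x x0; split; [exact: E|apply: D => //; exact: E].
Unshelve. all: by end_near. Qed.

Lemma polygammaE i x : 0 < x ->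
  polygamma i.+1 x = (-1) ^+ i * (i.+1`!%:R * hzeta i.+2 x).
Proof.
pose G n x : R := if n is n'.+1 then (-1) ^+ n' * (n'.+1`!%:R * hzeta n'.+2 x)
  else digam x.
move=> x0; rewrite /polygamma; apply: (derive1n_pos (G := G) _ _ i.+1 x0).1.
  exact: psiE.
move=> [|n] y y0; first by rewrite /G expr0 !mul1r; exact: is_derive_digam.
have D := is_derive_scalef ((-1) ^+ n) (is_derive_scalef n.+1`!%:R (is_derive_hzeta n y0)).
by apply: (is_derive_eq D); rewrite /G (factS n.+1) natrM exprS; ring.
Qed.

Lemma norm_polygamma i x : 0 < x ->
  `|polygamma i.+1 x| = i.+1`!%:R * hzeta i.+2 x.
Proof.
move=> x0; rewrite polygammaE// normrM normr_sign mul1r ger0_norm//.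
by rewrite mulr_ge0// ltW// hzeta_gt0.
Qed.

(** The [k]-th derivative is [G k]: the sign [(-1) ^+ k] and a positive factorial split off, and
    [k%:R * b] collects the derivatives that fall on the factor [x]. *)
Lemma completely_monotonic_polygamma i a b beta (f : R -> R) : 0 <= beta ->
  (forall x, 0 < x -> f x = a * `|polygamma i.+1 (x + beta)| +
    b * (x * `|polygamma i.+2 (x + beta)|)) ->
  completely_monotonic `]0, +oo[ f <->
  forall k x, 0 < x -> 0 <= (a - k%:R * b) * hzeta (i + k).+2 (x + beta) +
    b * x * ((i + k).+2%:R * hzeta (i + k).+3 (x + beta)).
Proof.
move=> beta0 fE.
pose G k x : R := (-1) ^+ k * ((i + k).+1`!%:R *
  ((a - k%:R * b) * hzeta (i + k).+2 (x + beta) +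
   b * x * ((i + k).+2%:R * hzeta (i + k).+3 (x + beta)))).
have fG x : 0 < x -> f x = G 0 x.
  move=> x0; rewrite fE// !norm_polygamma ?ltr_pwDl// /G addn0 (factS i.+1) natrM.
  ring.
have dz k x : 0 < x -> is_derive x 1 (fun x => hzeta k.+2 (x + beta))
    (- (k.+2%:R * hzeta k.+3 (x + beta))).
  move=> x0; have xb : 0 < x + beta by rewrite ltr_pwDl.
  have D := is_derive_compf (g := fun t => t + beta) (is_derive_hzeta k xb)
    (is_derive_addf (is_derive_id x (1 : R)) (is_derive_cst beta x 1)).
  by apply: (is_derive_eq D); rewrite addr0 mulr1.
have dG k x : 0 < x -> is_derive x 1 (G k) (G k.+1 x).
  move=> x0.
  have D := is_derive_scalef ((-1) ^+ k) (is_derive_scalef (i + k).+1`!%:R (is_derive_addf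
    (is_derive_scalef (a - k%:R * b) (dz (i + k)%N x x0))
    (is_derive_mulf (is_derive_scalef b (is_derive_id x (1 : R)))
      (is_derive_scalef (i + k).+2%:R (dz (i + k).+1 x x0))))).
  apply: (is_derive_eq D); rewrite /G addnS (factS (i + k).+1) natrM exprS.
  by rewrite -(natr1 k); ring.
have D := derive1n_pos fG dG.
split=> H k x x0.
  have [_] := H k x ltac:(by rewrite /= in_itv/= x0).
  rewrite (D k x x0).1 /G mulrA -exprMn mulrN1 opprK expr1n mul1r.
  by rewrite pmulr_rge0// ltr0n fact_gt0.
move: x0; rewrite /= in_itv/= andbT => x0; have [-> [? _]] := D k x x0; split=> //.
rewrite /G mulrA -exprMn mulrN1 opprK expr1n mul1r.
by rewrite pmulr_rge0 ?H// ltr0n fact_gt0.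
Qed.

End Polygamma.

(** * Inequalities between sums of inverse powers *)

Section Kernel.
Context {R : realType}.
Implicit Types (a b m u x t : R) (n N J : nat).

(* Gamma(n + 1, t) / n!, where Gamma(_, _) is the upper incomplete gamma function. *)
Fixpoint inc_gamma n t : R :=
  if n is n'.+1 then inc_gamma n' t + t ^+ n / n`!%:R * expR (- t)
  else expR (- t).

Lemma is_derive_inc_gamma n t :
  is_derive t 1 (inc_gamma n) (- (t ^+ n / n`!%:R * expR (- t))).
Proof.
elim: n => [|n IH].
  by rewrite expr0 fact0 divr1 mul1r; exact: is_derive_expRN.
have D := is_derive_addf IH (is_derive_mulf (is_derive_mulf
  (is_derive_expn n t) (is_derive_cst (n.+1`!%:R^-1 : R) t 1)) (is_derive_expRN t)).
apply: (is_derive_eq D); rewrite /cst factS natrM.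
by field; rewrite nat1r !pnatr_eq0 -lt0n fact_gt0.
Qed.

Lemma inc_gamma0 n : inc_gamma n 0 = 1.
Proof. by elim: n => [|n /= ->]; rewrite /= ?oppr0 ?expR0// exprS !mul0r addr0. Qed.

Lemma inc_gamma_ge0 n t : 0 <= t -> 0 <= inc_gamma n t.
Proof.
move=> t0; elim: n => [|n IH] /=; first exact: expR_ge0.
by rewrite addr_ge0// mulr_ge0 ?expR_ge0// divr_ge0// exprn_ge0.
Qed.

Lemma inc_gamma_le n : exists2 C, 0 <= C & forall t, 1 <= t -> inc_gamma n t <= C * t^-1.
Proof.
elim: n => [|n [C C0 CP]].
  have [C C0 CP] := @powR_expRN_le R 0; exists C => // t t1.
  by have := CP t t1; rewrite powRr0 mul1r.
have [D D0 DP] := @powR_expRN_le R n.+1%:R; exists (C + D) => [|t t1].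
  exact: addr_ge0.
rewrite mulrDl lerD ?CP// (le_trans _ (DP t t1))// powR_mulrn; last lra.
rewrite ler_wpM2r ?expR_ge0// ler_pdivrMr ?ltr0n ?fact_gt0// ler_peMr//.
  by rewrite exprn_ge0//; lra.
by rewrite ler1n fact_gt0.
Qed.

Lemma cvg_inc_gamma n u : 0 < u -> inc_gamma n (u * J%:R) @[J --> \oo] --> 0.
Proof.
move=> u0; have [C C0 CP] := inc_gamma_le n.
apply: (@squeeze_cvgr _ _ _ _ (fun=> 0) (fun J => C / u * (0 + J%:R)^-1)); last 2 first.
- exact: cvg_cst.
- by rewrite -[X in _ --> X](mulr0 (C / u)); apply: cvgMr; exact: cvg_invDn.
near=> J; have J1 : u^-1 <= J%:R by near: J; exact: nbhs_infty_ger.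
rewrite add0r inc_gamma_ge0 ?mulr_ge0 ?(ltW u0)//= (le_trans (CP _ _))//.
  by rewrite mulrC -ler_pdivrMr// div1r.
by rewrite invfM mulrA.
Unshelve. all: by end_near. Qed.

(* [Q] vanishes at infinity, and its derivative [q] is the defect of the hypothesis times
   [t ^+ n * expR (- (u * t)) / n`!]; the claim is [Q 0 <= 0]. *)
Lemma exprVn_diff_le m a b u n :
  (forall t, 0 <= t -> m * (1 - expR (- t)) <= a * t + b * (t * expR (- t))) ->
  0 < u ->
  m * (u ^- n.+1 - (u + 1) ^- n.+1) <=
    n.+1%:R * (a * u ^- n.+2 + b * (u + 1) ^- n.+2).
Proof.
move=> H u0; have u10 : 0 < u + 1 by lra.
pose tail k v t := inc_gamma k (v * t) / v ^+ k.+1.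
have dtail k v t : 0 < v -> is_derive t 1 (tail k v)
    (- (t ^+ k / k`!%:R * expR (- (v * t)))).
  move=> v0; have dv := is_derive_scalef v (is_derive_id t (1 : R)).
  have D := is_derive_mulf (is_derive_compf (is_derive_inc_gamma k (v * t)) dv)
    (is_derive_cst (v ^- k.+1 : R) t 1).
  apply: (is_derive_eq D); rewrite /cst exprMn exprS.
  by field; rewrite pnatr_eq0 -lt0n fact_gt0 expf_eq0 gt_eqF ?andbF.
have tail0 k v : tail k v 0 = v ^- k.+1.
  by rewrite /tail mulr0 inc_gamma0 mul1r.
have ctail k v : 0 < v -> tail k v J%:R @[J --> \oo] --> 0.
  by move=> v0; rewrite -[X in _ --> X](mul0r (v ^- k.+1)); apply: cvgMl; exact: cvg_inc_gamma.
pose Q t := m * (tail n u t - tail n (u + 1) t) -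
  n.+1%:R * (a * tail n.+1 u t + b * tail n.+1 (u + 1) t).
pose q t := t ^+ n / n`!%:R * expR (- (u * t)) *
  (a * t + b * (t * expR (- t)) - m * (1 - expR (- t))).
have dQ t : is_derive t 1 Q (q t).
  have D := is_derive_subf
    (is_derive_scalef m (is_derive_subf (dtail n u t u0) (dtail n (u + 1) t u10)))
    (is_derive_scalef n.+1%:R (is_derive_addf (is_derive_scalef a (dtail n.+1 u t u0))
      (is_derive_scalef b (dtail n.+1 (u + 1) t u10)))).
  apply: (is_derive_eq D); rewrite /q mulrDl mul1r opprD expRD factS natrM exprS.
  by field; rewrite nat1r !pnatr_eq0 -lt0n fact_gt0.
have q0 t : 0 <= t -> 0 <= q t.
  move=> t0; rewrite mulr_ge0 ?subr_ge0 ?H// mulr_ge0 ?expR_ge0//.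
  by rewrite divr_ge0// exprn_ge0.
suff : Q 0 <= 0 by rewrite /Q !tail0 subr_le0.
have cQ : Q J%:R @[J --> \oo] --> 0.
  have E0 : m * (0 - 0) - n.+1%:R * (a * 0 + b * 0) = 0 by ring.
  rewrite -[X in _ --> X]E0.
  apply: cvgB; apply: cvgMr; first by apply: cvgB; exact: ctail.
  by apply: cvgD; apply: cvgMr; exact: ctail.
apply: (ler_cvgn (cvg_cst (Q 0)) cQ); near=> J.
apply: (@is_derive_ge0_le _ Q q) => // t /andP[t0 _]; exact: q0.
Unshelve. all: by end_near. Qed.

End Kernel.

(** * Summation of the kernel inequality over integer shifts *)

Section Weighted_sums.
Context {R : realType}.
Implicit Types (a b m x t : R) (n J : nat).

Lemma cvg_shift_exprVn n x : 0 < x -> (x + J%:R) ^- n.+1 @[J --> \oo] --> 0.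
Proof.
move=> x0; apply: (@squeeze_cvgr _ _ _ _ (fun=> 0)
    (fun J => x ^- n * (x + J%:R)^-1)); last 2 first.
- exact: cvg_cst.
- by rewrite -[X in _ --> X](mulr0 (x ^- n)); apply: cvgMr; exact: cvg_invDn.
near=> J; have u0 := shift_gt0 J x0.
rewrite invr_ge0 exprn_ge0 ?(ltW u0)//= exprSr invfM.
rewrite ler_wpM2r ?invr_ge0 ?(ltW u0)// lef_pV2 ?posrE ?exprn_gt0//.
by rewrite lerXn2r ?nnegrE ?(ltW x0) ?(ltW u0)// lerDl.
Unshelve. all: by end_near. Qed.

Lemma cvg_index_shift_exprVn n x : 0 < x ->
  J%:R * (x + J%:R) ^- n.+2 @[J --> \oo] --> 0.
Proof.
move=> x0; apply: (@squeeze_cvgr _ _ _ _ (fun=> 0)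
    (fun J => (x + J%:R) ^- n.+1)); last 2 first.
- exact: cvg_cst.
- exact: cvg_shift_exprVn.
near=> J; have u0 := shift_gt0 J x0.
rewrite mulr_ge0 ?invr_ge0 ?exprn_ge0 ?(ltW u0)//=.
rewrite (exprS _ n.+1) invfM mulrA ler_piMl ?invr_ge0 ?exprn_ge0 ?(ltW u0)//.
by rewrite ler_pdivrMr// mul1r lerDr ltW.
Unshelve. all: by end_near. Qed.

Variables (m a b : R).
Hypothesis mab : forall t, 0 <= t ->
  m * (1 - expR (- t)) <= a * t + b * (t * expR (- t)).

(** Unweighted sum of [exprVn_diff_le] over [x + j]: the left side telescopes, and the shifted
    [b]-terms miss only the first term of the series. *)
Lemma hzeta_telescope n x : 0 < x ->
  m * x ^- n.+1 <= n.+1%:R * ((a + b) * hzeta n.+2 x - b * x ^- n.+2).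
Proof.
move=> x0.
have P J : m * (x ^- n.+1 - (x + J%:R) ^- n.+1) <=
    n.+1%:R * ((a + b) * hzeta_psum n.+2 x J - b * (x ^- n.+2 - (x + J%:R) ^- n.+2)).
  elim: J => [|J IH]; first by rewrite /hzeta_psum big_nil !addr0 !subrr !mulr0 subr0 mulr0.
  have := exprVn_diff_le n mab (shift_gt0 J x0).
  rewrite hzeta_psumS -(natr1 J) addrA; lra.
have c1 := @cvg_shift_exprVn n x x0; have c2 := @cvg_shift_exprVn n.+1 x x0.
have L : m * (x ^- n.+1 - (x + J%:R) ^- n.+1) @[J --> \oo] --> m * (x ^- n.+1 - 0).
  by apply: cvgMr; apply: cvgB => //; exact: cvg_cst.
have U : n.+1%:R * ((a + b) * hzeta_psum n.+2 x J - b * (x ^- n.+2 - (x + J%:R) ^- n.+2))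
    @[J --> \oo] --> n.+1%:R * ((a + b) * hzeta n.+2 x - b * (x ^- n.+2 - 0)).
  apply: cvgMr; apply: cvgB; first by apply: cvgMr; exact: cvg_hzeta.
  by apply: cvgMr; apply: cvgB => //; exact: cvg_cst.
have := ler_cvgn L U; rewrite !subr0; apply.
exact: nearW.
Qed.

(** With weights [j + 1], summation by parts turns the differences on the left into the series
    itself. On the right, reindexing gives the term at [u = x + j] the coefficient
    [(a + b) * j + a]; writing [j = u - x] splits it into the two series. *)
Lemma hzeta_weighted_telescope n x : 0 < x ->
  m * hzeta n.+2 x <=
    n.+2%:R * ((a + b) * hzeta n.+2 x + (a - (a + b) * x) * hzeta n.+3 x).
Proof.
move=> x0.
have P J : m * (hzeta_psum n.+2 x J - J%:R * (x + J%:R) ^- n.+2) <=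
    n.+2%:R * ((a + b) * hzeta_psum n.+2 x J +
      (a - (a + b) * x) * hzeta_psum n.+3 x J + b * (J%:R * (x + J%:R) ^- n.+3)).
  elim: J => [|J IH].
    by rewrite /hzeta_psum !big_nil !mul0r !mulr0 subr0 !addr0 !mulr0.
  have u0 := shift_gt0 J x0.
  have := ler_wpM2l (ler0n R J.+1) (exprVn_diff_le n.+1 mab u0).
  rewrite !hzeta_psumS -(natr1 J) addrA; move: IH.
  (* This is where [j = u - x] enters: both powers of [u] are expressed through [v], making the step
     linear up to products with [x] and [j]. *)
  have -> : (x + J%:R) ^- n.+2 = (x + J%:R) * (x + J%:R) ^- n.+3.
    by rewrite !exprS; field; rewrite expf_eq0 gt_eqF ?andbF.
  set v := (x + J%:R) ^- n.+3; set w := (x + J%:R + 1) ^- n.+2.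
  set z := (x + J%:R + 1) ^- n.+3; set j := J%:R; lra.
have c1 := @cvg_index_shift_exprVn n x x0; have c2 := @cvg_index_shift_exprVn n.+1 x x0.
have h1 := @cvg_hzeta R n x x0; have h2 := @cvg_hzeta R n.+1 x x0.
have L : m * (hzeta_psum n.+2 x J - J%:R * (x + J%:R) ^- n.+2) @[J --> \oo] -->
    m * (hzeta n.+2 x - 0) by apply: cvgMr; exact: cvgB.
have U : n.+2%:R * ((a + b) * hzeta_psum n.+2 x J +
      (a - (a + b) * x) * hzeta_psum n.+3 x J + b * (J%:R * (x + J%:R) ^- n.+3))
    @[J --> \oo] --> n.+2%:R * ((a + b) * hzeta n.+2 x +
      (a - (a + b) * x) * hzeta n.+3 x + b * 0).
  by apply: cvgMr; apply: cvgD; [apply: cvgD|]; apply: cvgMr.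
have := ler_cvgn L U; rewrite subr0 mulr0 addr0; apply.
exact: nearW.
Qed.

End Weighted_sums.

(** * Elementary inequalities for the exponential *)

Section Kernel_conditions.
Context {R : realType}.
Implicit Types (t beta : R).

Lemma subr_expRN_le t : 1 - expR (- t) <= t.
Proof. by have := expR_ge1Dx (- t); lra. Qed.

Lemma mul_expRN_le t : t * expR (- t) <= 1 - expR (- t).
Proof.
have := ler_wpM2l (expR_ge0 (- t)) (expR_ge1Dx t).
by rewrite [X in _ <= X]mulrC expRxMexpNx_1; lra.
Qed.

(** The trapezoid rule overestimates the integral of the convex [expR (- s)] over [[0, t]]. This
    yields the threshold 1/2 for [beta] and the monotonicity of [delta]. *)
Lemma subr_expRN_le_mean t : 0 <= t ->
  1 - expR (- t) <= 2^-1 * (t * (1 + expR (- t))).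
Proof.
move=> t0; pose f (s : R) : R := 2^-1 * (s * (1 + expR (- s))) - (1 - expR (- s)).
have df (s : R) : is_derive s 1 f (2^-1 * (1 - expR (- s) - s * expR (- s))).
  have e := is_derive_expRN s; have c := is_derive_cst (1 : R) s (1 : R).
  have D := is_derive_subf (is_derive_scalef 2^-1 (is_derive_mulf
    (is_derive_id s (1 : R)) (is_derive_addf c e))) (is_derive_subf c e).
  by apply: (is_derive_eq D); rewrite /cst; field.
have : f 0 <= f t.
  apply: (is_derive_ge0_le t0 (fun s _ => df s)) => s _.
  by rewrite mulr_ge0// subr_ge0 mul_expRN_le.
rewrite /f oppr0 expR0; lra.
Qed.

End Kernel_conditions.

(** * The function delta *)

Section Delta.
Context {R : realType}.
Implicit Types (t s beta : R).

Lemma expRB1_gt0 t : 0 < t -> 0 < expR t - 1.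
Proof. by move=> t0; rewrite subr_gt0 expR_gt1. Qed.

Lemma is_derive_delta t : 0 < t -> is_derive t 1 (@delta R)
  (expR t * (2 * (expR t - 1) - t * (expR t + 1)) / (expR t - 1) ^+ 3).
Proof.
move=> t0; have e0 := expRB1_gt0 t0.
have e := is_derive_expR t; have c := is_derive_cst (1 : R) t (1 : R).
have num := is_derive_addf (is_derive_mulf e (is_derive_subf (is_derive_id t (1 : R)) c)) c.
have den := is_derive_compf (g := fun s => expR s - 1) (is_derive_expn 1 (expR t - 1))
  (is_derive_subf e c).
have inv : is_derive t 1 (fun s => ((expR s - 1) ^+ 2)^-1)
    (- ((expR t - 1) ^+ 2) ^- 2 *: (2%:R * (expR t - 1) ^+ 1 * (expR t - 0))).
  by apply: (is_deriveV _ den); rewrite expf_eq0/= gt_eqF.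
apply: (is_derive_eq (is_derive_mulf num inv)); rewrite /cst /GRing.scale/=.
by field; rewrite gt_eqF.
Qed.

(** The sign of the derivative is that of [2 * (expR u - 1) - u * (expR u + 1)], which is
    [subr_expRN_le_mean] multiplied by [expR u]. *)
Lemma delta_nincr s t : 0 < s -> s <= t -> delta t <= delta s.
Proof.
move=> s0 st; rewrite -lerN2.
apply: (@is_derive_ge0_le _ (fun s => - delta s)
  (fun t => - (expR t * (2 * (expR t - 1) - t * (expR t + 1)) / (expR t - 1) ^+ 3))) => //.
  move=> u /andP[su _]; have ? := is_derive_delta (lt_le_trans s0 su).
  exact: is_deriveN.
move=> u /andP[su _]; have u0 := lt_le_trans s0 su.
have e0 := expRB1_gt0 u0.
rewrite -mulNr divr_ge0 ?exprn_ge0 ?(ltW e0)// -mulrN mulr_ge0 ?expR_ge0//.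
have := ler_wpM2l (expR_ge0 u) (subr_expRN_le_mean (ltW u0)).
have E := expRxMexpNx_1 u.
have -> : expR u * (1 - expR (- u)) = expR u - expR u * expR (- u) by ring.
have -> : expR u * (2^-1 * (u * (1 + expR (- u)))) =
  2^-1 * (u * (expR u + expR u * expR (- u))) by ring.
rewrite E; lra.
Qed.

(** The lower bound tends to 1/2 at 0; the numerator is at least [t ^+ 2 / 2] and the root of the
    denominator at most [t * expR t]. *)
Lemma delta_ge t : 0 < t -> expR (- (2 * t)) / 2 <= delta t.
Proof.
move=> t0; have e0 := expRB1_gt0 t0.
pose f (s : R) : R := expR s * (s - 1) + 1 - s ^+ 2 / 2.
have df (s : R) : is_derive s 1 f (s * (expR s - 1)).
  have e := is_derive_expR s; have c := is_derive_cst (1 : R) s (1 : R).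
  have D := is_derive_subf (is_derive_addf (is_derive_mulf e
    (is_derive_subf (is_derive_id s (1 : R)) c)) c)
    (is_derive_mulf (is_derive_expn 1 s) (is_derive_cst (2^-1 : R) s (1 : R))).
  by apply: (is_derive_eq D); rewrite /cst; field.
have num : t ^+ 2 / 2 <= expR t * (t - 1) + 1.
  have : f 0 <= f t.
    apply: (is_derive_ge0_le (ltW t0) (fun s _ => df s)) => s /andP[s0 _].
    by rewrite mulr_ge0// subr_ge0 -expR0 ler_expR.
  by rewrite /f expR0; lra.
have den : expR t - 1 <= t * expR t.
  have := ler_wpM2l (expR_ge0 t) (subr_expRN_le t).
  by rewrite mulrBr mulr1 expRxMexpNx_1 mulrC.
rewrite /delta ler_pdivlMr ?exprn_gt0// (le_trans _ num)//.
apply: (@le_trans _ _ (expR (- (2 * t)) / 2 * (t * expR t) ^+ 2)).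
  rewrite ler_wpM2l ?divr_ge0 ?expR_ge0// lerXn2r// ?nnegrE ?(ltW e0)//.
  by rewrite mulr_ge0 ?expR_ge0 ?ltW.
have E : expR (- (2 * t)) * expR t ^+ 2 = 1.
  by rewrite -expRM_natl mulrC expRxMexpNx_1.
rewrite exprMn (_ : _ * _ = (expR (- (2 * t)) * expR t ^+ 2) * (t ^+ 2 / 2)); last ring.
by rewrite E mul1r.
Qed.

Lemma delta_le t : 1 <= t -> delta t <= 8 / t.
Proof.
move=> t1; have t0 : 0 < t by lra.
have e0 := expRB1_gt0 t0.
have e1 : 1 + t <= expR t := expR_ge1Dx t.
have e2 : t ^+ 2 / 2 <= expR t.
  by have := expR_ge1Dxn 1 (ltW t0); rewrite (_ : 2`!%:R = 2 :> R)//; lra.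
rewrite /delta ler_pdivrMr ?exprn_gt0// mulrAC ler_pdivlMr//.
set e := expR t in e0 e1 e2 *; rewrite expr2.
apply: (@le_trans _ _ (e * t ^+ 2)); first by rewrite expr2; nra.
(* From [t ^+ 2 <= 2 * e]; the last step uses [e <= 2 * (e - 1)], valid as [2 <= e], whence the
   8. *)
apply: (@le_trans _ _ (2 * (e * e))); first by nra.
nra.
Qed.

Lemma delta_surj beta : 0 < beta < 2^-1 -> exists2 t, 0 < t & delta t = beta.
Proof.
move=> /andP[b0 b2].
(* Chosen so that [(1 - 2 * eps) / 2], a lower bound for [delta eps], is at least [beta]. *)
pose eps := (1 - 2 * beta) / 4; have eps0 : 0 < eps by rewrite divr_gt0//; lra.
have leps : beta <= delta eps.
  rewrite (le_trans _ (delta_ge eps0))//.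
  have := expR_ge1Dx (- (2 * eps)); rewrite /eps; lra.
pose T := Num.max 1 (8 / beta).
have T1 : 1 <= T by rewrite le_max lexx.
have Tb : 8 / beta <= T by rewrite le_max lexx orbT.
have lT : delta T <= beta.
  rewrite (le_trans (delta_le T1))// ler_pdivrMr; last lra.
  by rewrite mulrC -ler_pdivrMr.
have eT : eps <= T by rewrite /eps; lra.
have cd : {within `[eps, T], continuous (@delta R)}.
  apply: derivable_within_continuous => x; rewrite in_itv/= => /andP[ex _].
  by case: (is_derive_delta (lt_le_trans eps0 ex)).
have [|t + tb] := IVT eT cd (v := beta).
  by rewrite ge_min lT orbT le_max leps.
by rewrite in_itv/= => /andP[et _]; exists t => //; exact: lt_le_trans et.
Qed.

Lemma delta_invP beta : 0 < beta < 2^-1 ->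
  0 < delta_inv beta /\ delta (delta_inv beta) = beta.
Proof.
move=> b; have [t t0 tb] := delta_surj b.
have im : beta \in (@delta R) @` `]0, +oo[.
  by rewrite inE; exists t => //=; rewrite in_itv/= t0.
split; last exact: (pinvK (fun=> 0) im).
have S : set_surj `]0, +oo[ ((@delta R) @` `]0, +oo[) (@delta R) by [].
have := surjpinv_image_sub (dflt := fun=> 0) S.
move=> /(_ (delta_inv beta)); rewrite /= in_itv/= andbT; apply.
by exists beta => //; rewrite inE in im.
Qed.

(* The derivative of [s / (expR s - 1) + beta * s] is [beta - delta s]. *)
Lemma kernel_min beta s t : 0 < s -> delta s = beta -> 0 < t ->
  s / (expR s - 1) + beta * s <= t / (expR t - 1) + beta * t.
Proof.
move=> s0 sb t0; pose h (u : R) : R := u / (expR u - 1) + beta * u.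
have dh (u : R) : 0 < u -> is_derive u 1 h (beta - delta u).
  move=> u0; have e0 := expRB1_gt0 u0.
  have e := is_derive_expR u; have c := is_derive_cst (1 : R) u (1 : R).
  have inv : is_derive u 1 (fun s => (expR s - 1)^-1)
      (- (expR u - 1) ^- 2 *: (expR u - 0)).
    by apply: (is_deriveV _ (is_derive_subf e c)); rewrite gt_eqF.
  have D := is_derive_addf (is_derive_mulf (is_derive_id u (1 : R)) inv)
    (is_derive_scalef beta (is_derive_id u (1 : R))).
  apply: (is_derive_eq D); rewrite /GRing.scale/= /delta.
  by field; rewrite gt_eqF.
rewrite -!/(h _); have [st|/ltW ts] := leP s t.
  apply: (@is_derive_ge0_le _ h (fun u => beta - delta u)) => // u /andP[su _].
    exact: dh (lt_le_trans s0 su).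
  by rewrite subr_ge0 -sb delta_nincr.
rewrite -lerN2; apply: (@is_derive_ge0_le _ (fun u => - h u)
  (fun u => - (beta - delta u))) => // u /andP[tu us].
  by have ? := dh u (lt_le_trans t0 tu); exact: is_deriveN.
by rewrite opprB subr_ge0 -sb delta_nincr// (lt_le_trans t0 tu).
Qed.

(** Divided by [1 - expR (- t)], the right side is [t / (expR t - 1) + beta * t], and the constant
    on the left is the value of this function at [delta_inv beta], its minimum by [kernel_min]. *)
Lemma kernel_cond_delta_inv beta t : 0 < beta < 2^-1 -> 0 <= t ->
  (expR (delta_inv beta) / (expR (delta_inv beta) - 1) + beta - 1) * delta_inv beta
    * (1 - expR (- t)) <= beta * t + (1 - beta) * (t * expR (- t)).
Proof.
move=> b; rewrite le_eqVlt => /predU1P[<-|t0].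
  by rewrite oppr0 expR0 subrr !mulr0 mul0r mulr0 addr0.
have [s0 sb] := delta_invP b; set s := delta_inv beta in s0 sb *.
have e0 := expRB1_gt0 s0; have e1 := expRB1_gt0 t0.
have -> : (expR s / (expR s - 1) + beta - 1) * s = s / (expR s - 1) + beta * s.
  by field; rewrite gt_eqF.
have E := expRxMexpNx_1 t; have en := expR_gt0 (- t).
have w : 0 < 1 - expR (- t) by rewrite subr_gt0 expR_lt1 oppr_lt0.
have H := ler_wpM2r (ltW w) (kernel_min s0 sb t0).
apply: (le_trans H).
have -> : (t / (expR t - 1) + beta * t) * (1 - expR (- t)) =
   t / (expR t - 1) * (1 - expR (- t)) + beta * t * (1 - expR (- t)) by ring.
have -> : t / (expR t - 1) * (1 - expR (- t)) = t * expR (- t).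
  rewrite (_ : 1 - expR (- t) = (expR t - 1) * expR (- t)); last by rewrite mulrBl E mul1r.
  by field; rewrite gt_eqF.
by rewrite le_eqVlt; apply/orP; left; apply/eqP; ring.
Qed.

End Delta.

(** * Proof of the theorem *)

Section Necessity.
Context {R : realType}.
Implicit Types (x y a : R) (n : nat).

(** The triple (-1, 0, -1). The bound has the exact leading term both at 0 and at infinity, so it
    serves both limits. *)
Lemma hzeta_le n x : 0 < x ->
  n.+1%:R * hzeta n.+2 x <= (n.+1%:R + x) * x ^- n.+2.
Proof.
move=> x0; have H t : 0 <= t -> -1 * (1 - expR (- t)) <= 0 * t + -1 * (t * expR (- t)) :> R.
  by move=> _; have := mul_expRN_le t; lra.
have := hzeta_telescope H n x0.
have -> : x ^- n.+1 = x * x ^- n.+2.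
  by rewrite !exprS; field; rewrite expf_eq0 gt_eqF ?andbF.
lra.
Qed.

(** The triple (1, 1, 0); this is the comparison of the series with the integral of its terms. *)
Lemma hzeta_ge_integral n x : 0 < x -> x ^- n.+1 <= n.+1%:R * hzeta n.+2 x.
Proof.
move=> x0; have H t : 0 <= t -> 1 * (1 - expR (- t)) <= 1 * t + 0 * (t * expR (- t)) :> R.
  by move=> _; have := subr_expRN_le t; lra.
by have := hzeta_telescope H n x0; lra.
Qed.

(** Replaces the limits at 0 and at infinity in the necessity proofs, where cancelling a power of
    the argument leaves an affine inequality. *)
Lemma affine_le_pos (a b c d : R) :
  (forall x, 0 < x -> a + b * x <= c + d * x) -> a <= c /\ b <= d.
Proof.
move=> H; split; rewrite leNgt; apply/negP => lt.
  have D : 0 < `|d - b| + 1 by rewrite ltr_wpDl.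
  pose x := (a - c) / (2 * (`|d - b| + 1)).
  have x0 : 0 < x by rewrite divr_gt0 ?subr_gt0 ?mulr_gt0.
  have E : 2 * ((`|d - b| + 1) * x) = a - c.
    by rewrite /x; field; rewrite gt_eqF.
  have := H x x0; have := ler_wpM2r (ltW x0) (ler_norm (d - b)); nra.
pose x := (`|c - a| + 1) / (b - d).
have bd : 0 < b - d by rewrite subr_gt0.
have x0 : 0 < x by rewrite divr_gt0// ltr_wpDl.
have E : (b - d) * x = `|c - a| + 1 by rewrite /x mulrC mulfVK// gt_eqF.
have := H x x0; have := ler_norm (c - a); nra.
Qed.

Lemma exprVS_div n y : 0 < y -> y ^- n.+1 = y ^- n / y.
Proof.
by move=> y0; rewrite exprS; field; rewrite expf_eq0 gt_eqF ?andbF.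
Qed.

Lemma necessity_at0 n a :
  (forall x, 0 < x -> 0 <= a * hzeta n.+2 x - x * (n.+2%:R * hzeta n.+3 x)) ->
  n.+2%:R <= a.
Proof.
move=> H.
(* Needed to multiply the upper bound on [hzeta] by [a]. *)
have a0 : 0 <= a.
  have := H 1 ltr01; have := hzeta_gt0 n (@ltr01 R); have := hzeta_gt0 n.+1 (@ltr01 R).
  set z := hzeta n.+2 1; set w := hzeta n.+3 1 => w0 z0 h.
  rewrite -(pmulr_lge0 _ z0); have : 0 <= n.+2%:R * w by rewrite mulr_ge0 ?ltW.
  lra.
(* The behaviour at 0: the constant coefficients give the claim. *)
suff /affine_le_pos[] : forall x, 0 < x -> n.+2%:R + 0 * x <= a + a / n.+1%:R * x by [].
move=> x x0; have := H x x0.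
have := hzeta_ge n.+1 x0; rewrite exprVS_div//.
have := hzeta_le n x0; set w := x ^- n.+2.
have w0 : 0 < w by rewrite invr_gt0 exprn_gt0.
set z := hzeta n.+2 x; set z' := hzeta n.+3 x => h1 h2 h3.
have h1' : z <= (1 + x / n.+1%:R) * w.
  rewrite -(@ler_pM2l _ n.+1%:R)// (le_trans h1)//.
  by rewrite le_eqVlt; apply/orP; left; apply/eqP; field; rewrite nat1r pnatr_eq0.
have h2' : w <= x * z' by rewrite mulrC -ler_pdivrMr.
have := ler_wpM2l a0 h1'; have := ler_wpM2l (ler0n R n.+2) h2' => k1 k2.
rewrite -(ler_pM2r w0).
move: k1 k2 h3; set N := n.+2%:R; set c := _^-1; lra.
Qed.

Lemma necessity_infty_le n a :
  (forall x, 0 < x -> 0 <= x * (n.+2%:R * hzeta n.+3 x) - a * hzeta n.+2 x) ->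
  a <= n.+1%:R.
Proof.
move=> H; have [a0|a0] := leP a 0; first exact: le_trans a0 (ler0n _ _).
(* The behaviour at infinity: the slopes give the claim. *)
suff /affine_le_pos[_] : forall x, 0 < x -> 0 + a * x <= n.+1%:R * n.+2%:R + n.+1%:R * x by [].
move=> x x0; have := H x x0.
have := hzeta_ge_integral n x0; have := hzeta_le n.+1 x0.
have -> : x ^- n.+1 = x * x ^- n.+2.
  by rewrite !exprS; field; rewrite expf_eq0 gt_eqF ?andbF.
rewrite exprVS_div//; set w := x ^- n.+2.
have w0 : 0 < w by rewrite invr_gt0 exprn_gt0.
set z := hzeta n.+2 x; set z' := hzeta n.+3 x => h1 h2 h3.
have h1' : x * (n.+2%:R * z') <= (n.+2%:R + x) * w.
  by rewrite mulrC -ler_pdivlMr// -mulrA.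
have := ler_wpM2l (ltW a0) h2; have := ler_wpM2l (ler0n R n.+1) h1'.
have := ler_wpM2l (ler0n R n.+1) h3 => k1 k2 k3.
rewrite -(ler_pM2r w0); lra.
Qed.

Lemma necessity_infty_ge n a beta : 0 <= beta ->
  (forall x, 0 < x -> 0 <= a * hzeta n.+2 (x + beta) -
    x * (n.+2%:R * hzeta n.+3 (x + beta))) ->
  n.+1%:R <= a.
Proof.
move=> b0 H.
have a0 : 0 <= a.
  have b1 : 0 < 1 + beta by lra.
  have := H 1 ltr01; have := hzeta_gt0 n b1; have := hzeta_gt0 n.+1 b1.
  set z := hzeta n.+2 _; set w := hzeta n.+3 _ => w0 z0 h.
  rewrite -(pmulr_lge0 _ z0); have : 0 <= n.+2%:R * w by rewrite mulr_ge0 ?ltW.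
  lra.
suff /affine_le_pos[_] : forall x, 0 < x ->
  0 + n.+1%:R * x <= a * (n.+1%:R + beta) + a * x by [].
move=> x x0; have := H x x0; set y := x + beta.
have y0 : 0 < y by rewrite ltr_pwDl.
have := hzeta_ge_integral n.+1 y0; have := hzeta_le n y0.
set w := y ^- n.+2; have w0 : 0 < w by rewrite invr_gt0 exprn_gt0.
set z := hzeta n.+2 y; set z' := hzeta n.+3 y => h1 h2 h3.
have := ler_wpM2l a0 h1; have := ler_wpM2l (ltW x0) h2.
have := ler_wpM2l (ler0n R n.+1) h3.
move=> k1 k2 k3; have := ler_wpM2l (ler0n R n.+1) k2 => k4.
rewrite -(ler_pM2r w0); rewrite /y in k1 k2 k3 k4 *; lra.
Qed.

End Necessity.

Theorem theorem2 (R : realType) (i : nat) (hi : (0 < i)%N)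
    (alpha beta : R) (hbeta : 0 <= beta) :
  [/\ completely_monotonic `]0, +oo[
        (fun x : R => alpha * `|polygamma i x| - x * `|polygamma i.+1 x|)
        <-> i%:R + 1 <= alpha,
      completely_monotonic `]0, +oo[
        (fun x : R => x * `|polygamma i.+1 x| - alpha * `|polygamma i x|)
        <-> alpha <= i%:R,
      2^-1 <= beta ->
        (completely_monotonic `]0, +oo[
          (fun x : R => alpha * `|polygamma i (x + beta)|
                        - x * `|polygamma i.+1 (x + beta)|)
         <-> i%:R <= alpha)
    & 0 < beta < 2^-1 ->
        i%:R + 1 - (expR (delta_inv beta) / (expR (delta_inv beta) - 1)
                    + beta - 1) * delta_inv beta <= alpha ->
        completely_monotonic `]0, +oo[
          (fun x : R => alpha * `|polygamma i (x + beta)|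
                        - x * `|polygamma i.+1 (x + beta)|)].
Proof.
case: i hi => // i _.
have natE k : (i + k).+2%:R = i.+1%:R + 1 + k%:R :> R.
  by rewrite !natr1 -natrD addSn.
have C0 := @completely_monotonic_polygamma R i alpha (-1) 0
  (fun x => alpha * `|polygamma i.+1 x| - x * `|polygamma i.+2 x|) (lexx 0).
have C1 := @completely_monotonic_polygamma R i (- alpha) 1 0
  (fun x => x * `|polygamma i.+2 x| - alpha * `|polygamma i.+1 x|) (lexx 0).
have Cb := @completely_monotonic_polygamma R i alpha (-1) beta
  (fun x => alpha * `|polygamma i.+1 (x + beta)| - x * `|polygamma i.+2 (x + beta)|) hbeta.
have {}C0 := C0 ltac:(by move=> x _; rewrite addr0 mulN1r).
have {}C1 := C1 ltac:(by move=> x _; rewrite addr0 mul1r mulNr addrC).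
have {}Cb := Cb ltac:(by move=> x _; rewrite mulN1r).
(* With [a = beta] and [b = 1 - beta] at [y = x + beta], one has [a + b = 1] and
   [a - (a + b) * y = - x], which are the coefficients of the criterion [Cb]. *)
have suff_b m : (forall t, 0 <= t ->
      m * (1 - expR (- t)) <= beta * t + (1 - beta) * (t * expR (- t))) ->
    i.+1%:R + 1 - m <= alpha ->
  completely_monotonic `]0, +oo[
    (fun x : R => alpha * `|polygamma i.+1 (x + beta)|
                  - x * `|polygamma i.+2 (x + beta)|).
  move=> mP ma; apply/Cb => k x x0.
  have y0 : 0 < x + beta by rewrite ltr_pwDl.
  have := hzeta_weighted_telescope mP (i + k) y0.
  have := hzeta_gt0 (i + k) y0; set z := hzeta _ _; set z' := hzeta _ _.
  rewrite natE.
  move=> z0 H; have := ler_wpM2r (ltW z0) ma; lra.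
split.
- split=> [/C0 H|ha].
    rewrite natr1; apply: necessity_at0 => x x0.
    by have := H 0 x x0; rewrite addn0 addr0; lra.
  apply/C0 => k x x0; rewrite addr0.
  (* The triple (0, 0, 1): again [a + b = 1] and [a - (a + b) * x = - x], now with [m = 0]. *)
  have P t : 0 <= t -> 0 * (1 - expR (- t)) <= 0 * t + 1 * (t * expR (- t)) :> R.
    by move=> t0; rewrite !mul0r add0r mul1r mulr_ge0 ?expR_ge0.
  have := hzeta_weighted_telescope P (i + k) x0.
  have := hzeta_gt0 (i + k) x0; set z := hzeta _ _; set z' := hzeta _ _.
  rewrite natE.
  move=> z0 H; have := ler_wpM2r (ltW z0) ha; lra.
- split=> [/C1 H|ha].
    apply: necessity_infty_le => x x0.
    by have := H 0 x x0; rewrite addn0 addr0; lra.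
  apply/C1 => k x x0; rewrite addr0.
  (* The triple (-1, 0, -1) reverses the signs, as the negated function requires, and [m = -1]
     accounts for the bound [i] instead of [i + 1]. *)
  have P t : 0 <= t -> -1 * (1 - expR (- t)) <= 0 * t + -1 * (t * expR (- t)) :> R.
    by move=> _; have := mul_expRN_le t; lra.
  have := hzeta_weighted_telescope P (i + k) x0.
  have := hzeta_gt0 (i + k) x0; set z := hzeta _ _; set z' := hzeta _ _.
  rewrite natE.
  move=> z0 H; have := ler_wpM2r (ltW z0) ha; lra.
- move=> b2; split=> [/Cb H|ha].
    apply: (necessity_infty_ge hbeta) => x x0.
    by have := H 0 x x0; rewrite addn0; lra.
  apply: (suff_b 1); last lra.
  move=> t t0; rewrite mul1r (le_trans (subr_expRN_le_mean t0))//.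
  (* The excess over the case [beta = 1/2] is [(beta - 2^-1) * (t * (1 - expR (- t)))]. *)
  have : 0 <= t * (1 - expR (- t)); last by have := expR_gt0 (- t); nra.
  by rewrite mulr_ge0// subr_ge0 expR_le1 oppr_le0.
- move=> b ha; apply: suff_b ha => t; exact: kernel_cond_delta_inv.
Qed.
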